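(* Let $G^*=G*_{t,\phi:A\to B}$ be an HNN extension of a finitely generated group $G$ such that the associated subgroups $A,B$ are also finitely generated. Assume that the following conditions hold: (i) the rational subset membership problem is decidable in $G$; (ii) $A\leq G$ is effectively closed for rational intersections. Then for any $d\geq 0$ and any finite subsets $W_0,W_1,\dots,W_d,W_1',\dots,W_d'\subseteq G$, the membership problem in $G^*$ for the submonoid $M$ of $G^*$ generated by $$W_0\cup W_1t\cup W_2t^2\cup\dots\cup W_dt^d\cup tW_1'\cup t^2W_2'\cup\dots\cup t^dW_d'$$ is decidable.
   Context: For a group $G$ with isomorphic subgroups $A,B\le G$ and an isomorphism $\phi:A\to B$, $G^*=G*_{t,\phi:A\to B}$ denotes the HNN extension of $G$ with stable letter $t$ and associated subgroups $A,B$, i.e. the group obtained from $G$ by adding a new generator $t$ and the relations $t^{-1}at=a\phi$ for all $a\in A$. The group $G$ is regarded as a subgroup of $G^*$. $G$ comes with a fixed finite generating set $X$, and $G^*$ with the generating set $X\cup\{t\}$; $\phi$ is given by fixed words over $X$ for a finite set of generators of $A$ and for their images. For a set $\Omega$ write $\overline{\Omega}=\Omega\cup\Omega^{-1}$. Let $K$ be a group with finite generating set $\Omega$ and canonical homomorphism $\tau:\overline{\Omega}^*\to K$. - The rational subsets $\mathrm{Rat}(K)$ form the smallest class of subsets of $K$ containing all finite subsets and closed under union, product and submonoid generation; equivalently, they are the sets $L(\mathcal A)\tau$, where $L(\mathcal A)$ is the language of a finite state automaton (FSA) $\mathcal A$ over $\overline{\Omega}$. - $K$ has decidable rational subset membership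 problem if there is an algorithm which, given an FSA $\mathcal A$ over $\overline{\Omega}$ and a word $w\in\overline{\Omega}^*$, decides whether $w\tau\in L(\mathcal A)\tau$. - A finitely generated subgroup $H\le K$ is effectively closed for rational intersections if $R\cap H\in \mathrm{Rat}(K)$ for all $R\in\mathrm{Rat}(K)$ and, moreover, there is an algorithm which, given an FSA $\mathcal A$ over $\overline{\Omega}$, computes an FSA $\mathcal A_H$ over $\overline{\Omega}$ such that $L(\mathcal A_H)\tau=(L(\mathcal A)\tau)\cap H$. - For a finitely generated submonoid $N$ of $K$, the membership problem for $N$ in $K$ is decidable if there is an algorithm which, given any word $w\in\overline{\Omega}^*$, decides whether $w\tau\in N$. *)

(* Defs.v *)
From HB Require Import structures.
From mathcomp Require Import all_boot.
From mathcomp Require Import boolp classical_sets functions cardinality.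

Set Implicit Arguments.
Unset Strict Implicit.
Unset Printing Implicit Defensive.

Import Algebra.

Local Open Scope classical_set_scope.
Local Open Scope group_scope.

(* General recursive functions of any arity: the total functions obtained from
   zero, successor and projections by composition, primitive recursion and
   minimisation of regular functions, i.e. of functions having a zero in their
   first argument for all values of the others.  Restricting minimisation to
   regular functions yields all total computable functions (Kleene normal
   form) without introducing partial functions. *)
Inductive recursive : forall k, (k.-tuple nat -> nat) -> Prop :=
| recursive_zero : recursive (fun _ : 0.-tuple nat => 0)
| recursive_succ : recursive (fun v : 1.-tuple nat => (thead v).+1)
| recursive_proj k (i : 'I_k) : recursive (fun v : k.-tuple nat => tnth v i)
| recursive_comp m k (f : m.-tuple nat -> nat)
    (g : 'I_m -> k.-tuple nat -> nat) :
    recursive f -> (forall i, recursive (g i)) ->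
    recursive (fun v : k.-tuple nat => f [tuple g i v | i < m])
| recursive_prim k (f : k.-tuple nat -> nat) (g : k.+2.-tuple nat -> nat)
    (h : k.+1.-tuple nat -> nat) :
    recursive f -> recursive g ->
    (forall v : k.-tuple nat, h [tuple of 0 :: v] = f v) ->
    (forall n (v : k.-tuple nat),
       h [tuple of n.+1 :: v] = g [tuple of n :: h [tuple of n :: v] :: v]) ->
    recursive h
| recursive_min k (f : k.+1.-tuple nat -> nat) (h : k.-tuple nat -> nat) :
    recursive f ->
    (forall v : k.-tuple nat, f [tuple of h v :: v] = 0) ->
    (forall (v : k.-tuple nat) n, (n < h v)%N -> f [tuple of n :: v] <> 0) ->
    recursive h.

(* Algorithms act on data through the Goedel numbering [pickle].  This is
   meaningful because it is only used below for types built from [nat], [bool],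
   finite types, pairs, options and sequences, where [pickle] is effective. *)
Definition computable (T U : countType) (f : T -> U) : Prop :=
  exists2 r : 1.-tuple nat -> nat,
    recursive r & forall x, r [tuple pickle x] = pickle (f x).

Definition decidable_pred (T : countType) (P : T -> Prop) : Prop :=
  exists2 f : T -> bool, computable f & forall x, f x <-> P x.

Section GeneratedSubsets.
Variable K : groupType.

Definition is_subgroup (H : set K) : Prop := group_closed (mem H).
Definition is_submonoid (N : set K) : Prop := monoid_closed (mem N).

Definition subgroup_gen (S : set K) : set K := smallest is_subgroup S.
Definition submonoid_gen (S : set K) : set K := smallest is_submonoid S.

Definition fg_subgroup (H : set K) : Prop :=
  exists2 S : set K, finite_set S & H = subgroup_gen S.

Inductive rational : set K -> Prop :=
| rational_finite S : finite_set S -> rational S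
| rational_union R S : rational R -> rational S -> rational (R `|` S)
| rational_mul R S :
    rational R -> rational S -> rational [set x * y | x in R & y in S]
| rational_star R : rational R -> rational (submonoid_gen R).

End GeneratedSubsets.

(* A nondeterministic automaton; its states are the natural numbers occurring
   in the three lists, and a transition (p, a, q) goes from p to q. *)
Record fsa (L : Type) := FSA {
  fsa_init : seq nat;
  fsa_trans : seq (nat * L * nat);
  fsa_final : seq nat }.

Definition fsa_to_prod L (M : fsa L) :=
  (fsa_init M, fsa_trans M, fsa_final M).
Definition fsa_of_prod L (x : seq nat * seq (nat * L * nat) * seq nat) :=
  FSA x.1.1 x.1.2 x.2.
Lemma fsa_to_prodK L : cancel (@fsa_to_prod L) (@fsa_of_prod L).
Proof. by case. Qed.

HB.instance Definition _ (L : countType) :=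
  Countable.copy (fsa L) (can_type (@fsa_to_prodK L)).

Fixpoint fsa_path (L : eqType) (M : fsa L) (p : nat) (w : seq L) (q : nat) :=
  if w is a :: w' then
    exists2 r, (p, a, r) \in fsa_trans M & fsa_path M r w' q
  else p = q.

Definition fsa_lang (L : eqType) (M : fsa L) : set (seq L) :=
  [set w | exists p q,
     [/\ p \in fsa_init M, q \in fsa_final M & fsa_path M p w q]].

(* The letter (i, true) stands for the generator indexed by i, and (i, false)
   for its formal inverse. *)
Notation letter I := (I * bool)%type.

Section AlgorithmicProblems.
Variables (I : finType) (K : groupType) (X : I -> K).

Definition generates : Prop := subgroup_gen (range X) = setT.

Definition letter_val (a : letter I) : K := if a.2 then X a.1 else (X a.1)^-1.

Definition word_val (w : seq (letter I)) : K := \prod_(a <- w) letter_val a.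

Definition fsa_val (M : fsa (letter I)) : set K := word_val @` fsa_lang M.

Definition decidable_rational_membership : Prop :=
  decidable_pred (fun Mw : fsa (letter I) * seq (letter I) =>
    fsa_val Mw.1 (word_val Mw.2)).

Definition effectively_closed (H : set K) : Prop :=
  [/\ is_subgroup H, fg_subgroup H,
      forall R, rational R -> rational (R `&` H) &
      exists2 F : fsa (letter I) -> fsa (letter I),
        computable F & forall M, fsa_val (F M) = fsa_val M `&` H].

Definition decidable_membership (N : set K) : Prop :=
  decidable_pred (fun w : seq (letter I) => N (word_val w)).

End AlgorithmicProblems.

(* phi is total, but only its restriction to A matters. *)
Definition subgroup_iso (G : groupType) (A B : set G) (phi : G -> G) : Prop :=
  set_bij A B phi /\ {in A &, {morph phi : x y / x * y}}.

Section HNN.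
Variables (G : groupType) (A : set G) (phi : G -> G).

(* [inl g] stands for the element g of G, [inr true] for the stable letter t
   and [inr false] for its formal inverse. *)
Notation hnn_word := (seq (G + bool)).

Inductive hnn_relator : hnn_word -> hnn_word -> Prop :=
| hnn_one : hnn_relator [:: inl 1] [::]
| hnn_mul g h : hnn_relator [:: inl g; inl h] [:: inl (g * h)]
| hnn_inv b : hnn_relator [:: inr b; inr (~~ b)] [::]
| hnn_conj a :
    A a -> hnn_relator [:: inr false; inl a; inr true] [:: inl (phi a)].

Inductive hnn_equiv : hnn_word -> hnn_word -> Prop :=
| hnn_equiv_step u v r s :
    hnn_relator r s -> hnn_equiv (u ++ r ++ v) (u ++ s ++ v)
| hnn_equiv_refl u : hnn_equiv u u
| hnn_equiv_sym u v : hnn_equiv u v -> hnn_equiv v u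
| hnn_equiv_trans v u w : hnn_equiv u v -> hnn_equiv v w -> hnn_equiv u w.

Definition hnn_rel : rel hnn_word := fun u v => `[< hnn_equiv u v >].

Lemma hnn_rel_refl : reflexive hnn_rel.
Proof. by move=> u; apply/asboolP/hnn_equiv_refl. Qed.
Lemma hnn_rel_sym : symmetric hnn_rel.
Proof. by move=> u v; apply/asboolP/asboolP; apply: hnn_equiv_sym. Qed.
Lemma hnn_rel_trans : transitive hnn_rel.
Proof.
move=> v u w /asboolP uv /asboolP vw.
exact/asboolP/(hnn_equiv_trans uv vw).
Qed.

Canonical hnn_equiv_rel := EquivRel hnn_rel hnn_rel_refl hnn_rel_sym
  hnn_rel_trans.

Definition HNN := {eq_quot hnn_equiv_rel}%qT.

HB.instance Definition _ := Choice.on HNN.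

Definition hnn_class (u : hnn_word) : HNN := (\pi_HNN u)%qT.

Lemma hnn_classP u v : hnn_class u = hnn_class v <-> hnn_equiv u v.
Proof. by split=> [/eqmodP/asboolP | uv] //; apply/eqmodP/asboolP. Qed.

Lemma hnn_equiv_cat u1 u2 v1 v2 :
  hnn_equiv u1 u2 -> hnn_equiv v1 v2 -> hnn_equiv (u1 ++ v1) (u2 ++ v2).
Proof.
move=> hu hv; apply: (@hnn_equiv_trans (u2 ++ v1)).
  elim: hu => {u1 u2}[u v r s rs | u | u v _ | v u w _ IH1 _ IH2].
  - by rewrite -!catA; apply: hnn_equiv_step.
  - exact: hnn_equiv_refl.
  - exact: hnn_equiv_sym.
  - exact: hnn_equiv_trans IH1 IH2.
elim: hv => {v1 v2}[u v r s rs | u | u v _ | v u w _ IH1 _ IH2].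
- by rewrite !(catA u2); apply: hnn_equiv_step.
- exact: hnn_equiv_refl.
- exact: hnn_equiv_sym.
- exact: hnn_equiv_trans IH1 IH2.
Qed.

Definition hnn_letter_inv (a : G + bool) : G + bool :=
  match a with inl g => inl g^-1 | inr b => inr (~~ b) end.
Definition hnn_word_inv (u : hnn_word) := rev (map hnn_letter_inv u).

Lemma hnn_word_invK : involutive hnn_word_inv.
Proof.
move=> u; rewrite /hnn_word_inv map_rev revK -map_comp map_id_in //.
by case=> [g | b] _ /=; rewrite ?invgK ?negbK.
Qed.

Lemma hnn_word_invr u : hnn_equiv (u ++ hnn_word_inv u) [::].
Proof.
elim: u => [|a u IH]; first exact: hnn_equiv_refl.
rewrite /hnn_word_inv /= rev_cons -cats1 -/(hnn_word_inv u) catA.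
apply: (@hnn_equiv_trans [:: a; hnn_letter_inv a]).
  apply: (@hnn_equiv_cat (a :: (u ++ hnn_word_inv u)) [:: a]);
    last exact: hnn_equiv_refl.
  exact: (@hnn_equiv_cat [:: a] [:: a] _ [::] (hnn_equiv_refl _) IH).
case: a => [g | b] /=.
  apply: (@hnn_equiv_trans [:: inl 1]).
    rewrite -(mulgV g).
    exact: (@hnn_equiv_step [::] [::] _ _ (hnn_mul g g^-1)).
  exact: (@hnn_equiv_step [::] [::] _ _ hnn_one).
exact: (@hnn_equiv_step [::] [::] _ _ (hnn_inv b)).
Qed.

Lemma hnn_word_invl u : hnn_equiv (hnn_word_inv u ++ u) [::].
Proof. by have := hnn_word_invr (hnn_word_inv u); rewrite hnn_word_invK. Qed.

Lemma hnn_equiv_inv u v :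
  hnn_equiv u v -> hnn_equiv (hnn_word_inv u) (hnn_word_inv v).
Proof.
move=> uv; set u' := hnn_word_inv u; set v' := hnn_word_inv v.
apply: (@hnn_equiv_trans (u' ++ (v ++ v'))).
  rewrite -[X in hnn_equiv X]cats0.
  exact/hnn_equiv_cat/hnn_equiv_sym/hnn_word_invr/hnn_equiv_refl.
rewrite catA -[X in hnn_equiv _ X]cat0s.
apply: hnn_equiv_cat; last exact: hnn_equiv_refl.
apply: hnn_equiv_trans (hnn_word_invl u).
apply: hnn_equiv_cat; first exact: hnn_equiv_refl.
exact: hnn_equiv_sym.
Qed.

Definition hnn_muln (x y : HNN) : HNN := hnn_class (repr x ++ repr y).
Definition hnn_onen : HNN := hnn_class [::].
Definition hnn_invn (x : HNN) : HNN := hnn_class (hnn_word_inv (repr x)).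

Lemma hnn_reprK (x : HNN) : hnn_class (repr x) = x.
Proof. exact: reprK. Qed.

Lemma hnn_repr u : hnn_equiv (repr (hnn_class u)) u.
Proof. exact/hnn_classP/hnn_reprK. Qed.

Lemma hnn_mulE u v :
  hnn_muln (hnn_class u) (hnn_class v) = hnn_class (u ++ v).
Proof. by apply/hnn_classP/hnn_equiv_cat; apply: hnn_repr. Qed.

Lemma hnn_invE u : hnn_invn (hnn_class u) = hnn_class (hnn_word_inv u).
Proof. exact/hnn_classP/hnn_equiv_inv/hnn_repr. Qed.

Fact hnn_mulA : associative hnn_muln.
Proof.
move=> x y z; rewrite -(hnn_reprK x) -(hnn_reprK y) -(hnn_reprK z).
by rewrite !hnn_mulE catA.
Qed.
Fact hnn_mul1 : left_id hnn_onen hnn_muln.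
Proof. by move=> x; rewrite -(hnn_reprK x) hnn_mulE. Qed.
Fact hnn_mulr1 : right_id hnn_onen hnn_muln.
Proof. by move=> x; rewrite -(hnn_reprK x) hnn_mulE cats0. Qed.
Fact hnn_mulV : left_inverse hnn_onen hnn_invn hnn_muln.
Proof.
move=> x; rewrite -(hnn_reprK x) hnn_invE hnn_mulE.
exact/hnn_classP/hnn_word_invl.
Qed.
Fact hnn_mulrV : right_inverse hnn_onen hnn_invn hnn_muln.
Proof.
move=> x; rewrite -(hnn_reprK x) hnn_invE hnn_mulE.
exact/hnn_classP/hnn_word_invr.
Qed.

HB.instance Definition _ := isGroup.Build HNN
  hnn_mulA hnn_mul1 hnn_mulr1 hnn_mulV hnn_mulrV.

Definition hnn_emb (g : G) : HNN := hnn_class [:: inl g].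
Definition hnn_t : HNN := hnn_class [:: inr true].

Lemma hnn_embM : {morph hnn_emb : g h / g * h}.
Proof.
move=> g h; rewrite [RHS]hnn_mulE; apply/hnn_classP/hnn_equiv_sym.
exact: (@hnn_equiv_step [::] [::] _ _ (hnn_mul g h)).
Qed.

Lemma hnn_tJ a : A a -> hnn_t^-1 * hnn_emb a * hnn_t = hnn_emb (phi a).
Proof.
move=> Aa; rewrite [_^-1]hnn_invE [_ * hnn_emb a]hnn_mulE [LHS]hnn_mulE.
apply/hnn_classP.
exact: (@hnn_equiv_step [::] [::] _ _ (hnn_conj Aa)).
Qed.

Definition hnn_generators (I : Type) (X : I -> G) (i : option I) : HNN :=
  if i is Some j then hnn_emb (X j) else hnn_t.

End HNN.

(* Main.v *)
Require Import Defs.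
From HB Require Import structures.
From mathcomp Require Import all_boot.
From mathcomp Require Import boolp classical_sets functions cardinality.

(* An element of the submonoid is represented by a word [g_0 t g_1 ... t g_k]
   without [t^-1], and such a word is reduced.  By Britton's lemma a reduced word
   equal to it has the same shape, [x_0 t x_1 ... t x_k].  Read the generators as
   a finite automaton whose states [p] are the parts of generators that remain to
   be read, and let [C_p(l)], for [l = x_0, ..., x_{i-1}], be the set of all [c]
   such that [x_0 t ... x_{i-1} t c] is represented by a word over the generators
   ending with a letter [t] and leaving [p] to be read.  Then
     C_p'(l, x) = phi (A /\ U_p x^-1 C_p(l) S_{p,p'})
   where [S_{p,p'}] is a fixed rational subset of [G].  Hence every [C_p(l)] is
   rational and an automaton for it can be computed, and membership of the input
   amounts to [x_k \in U_p C_p(l) F_p] with [F_p] rational, a rational subset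
   membership problem in [G].
   To apply [phi] to a rational subset of [A], its automaton over the generators
   of [G] has to be turned into one over the generators of [A].  For every useful
   state [q] there is a word [u_q] such that [u_p a u_q^-1] lies in [A] for every
   useful transition [(p, a, q)].  These words are found by unbounded search, and
   the new labels telescope along accepting paths. *)

Set Implicit Arguments.
Unset Strict Implicit.
Unset Printing Implicit Defensive.
Import Algebra.
Local Open Scope classical_set_scope.
Local Open Scope nat_scope.

(** * Recursive functions *)

(** The obstacle is that one element can have infinitely many representations over the generators,
    which differ from the reduced form of the input by elements of the associated subgroups moved
    across each [t]. The recursion for [C_p] records all these corrections at once: if a prefix read
    so far equals [x_0 t ... x_{i-1} t c], then appending [h t] gives [x_0 t ... x_{i-1} t x t c']
    exactly when [a = x^-1 c h] lies in [A] and [c' = phi a], because [a t = t phi a]. So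
    intersections are taken with [A] only, and always before [phi] is applied. The sets [S_{p,p'}]
    can be infinite, since generators lying in [G] may be repeated between two letters [t]; this
    forces rational instead of finite sets. Data that do not depend on the input, such as automata
    for [S_{p,p'}] and [F_p] or words for the images of generators, are finitely many constants and
    are chosen without an algorithm. Whatever depends on the input is shown to be a recursive
    function of Goedel numbers. Bringing the input to reduced form also has to be effective:
    membership in [A] and [B] is decided as rational membership in [G], and [phi] and its inverse
    are evaluated by search. *)

Lemma recursive_ext k (f g : k.-tuple nat -> nat) :
  f =1 g -> recursive f -> recursive g.
Proof. by move=> /funext->. Qed.

Lemma recursive_comp1 (h : nat -> nat) k (f : k.-tuple nat -> nat) :
  recursive (fun v : 1.-tuple nat => h (thead v)) -> recursive f ->
  recursive (fun v => h (f v)).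
Proof.
move=> rh rf; apply: recursive_ext (recursive_comp (g := fun=> f) rh _) => // v.
by rewrite /thead tnth_mktuple.
Qed.

Lemma recursive_comp2 (h : nat -> nat -> nat) k (f g : k.-tuple nat -> nat) :
  recursive (fun v : 2.-tuple nat => h (tnth v ord0) (tnth v ord_max)) ->
  recursive f -> recursive g -> recursive (fun v => h (f v) (g v)).
Proof.
move=> rh rf rg.
pose G (i : 'I_2) := if i == ord0 then f else g.
apply: recursive_ext (recursive_comp (g := G) rh _) => [v|i].
  by rewrite !tnth_mktuple.
by rewrite /G; case: ifP.
Qed.

Lemma recursive_subst k (h : k.+1.-tuple nat -> nat) (N : k.-tuple nat -> nat) :
  recursive h -> recursive N -> recursive (fun v => h [tuple of N v :: v]).
Proof.
move=> rh rN.
pose G (i : 'I_k.+1) v := if unlift ord0 i is Some j then tnth v j else N v.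
apply: recursive_ext (recursive_comp (g := G) rh _) => [v|i].
  congr h; apply: eq_from_tnth => i; rewrite tnth_mktuple /G.
  by case: unliftP => [j|] ->; rewrite ?tnth0 // tnthS.
by rewrite /G; case: (unlift _ i) => // j; exact: recursive_proj.
Qed.

Definition ttl (k : nat) (v : k.+1.-tuple nat) : k.-tuple nat :=
  [tuple of behead v].

Lemma ttl_cons k n (v : k.-tuple nat) : ttl [tuple of n :: v] = v.
Proof. exact: val_inj. Qed.

Lemma recursive_behead k (f : k.-tuple nat -> nat) :
  recursive f -> recursive (fun v : k.+1.-tuple nat => f (ttl v)).
Proof.
move=> rf.
pose G (i : 'I_k) (v : k.+1.-tuple nat) := tnth v (lift ord0 i).
apply: recursive_ext (recursive_comp (g := G) rf _) => [v|i].
  by congr f; apply: eq_from_tnth => i; rewrite tnth_mktuple tnth_behead /G;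
    congr tnth; apply: val_inj; rewrite /= inordK // ltnS.
exact: recursive_proj.
Qed.

Lemma recursive_const k c : recursive (fun _ : k.-tuple nat => c).
Proof.
elim: c => [|c IH]; last exact: recursive_comp1 recursive_succ IH.
have g (i : 'I_0) : k.-tuple nat -> nat by case: i.
by apply: recursive_ext (recursive_comp (g := g) recursive_zero _) => // -[].
Qed.

Lemma recursive_S k (f : k.-tuple nat -> nat) :
  recursive f -> recursive (fun v => (f v).+1).
Proof. exact: recursive_comp1 recursive_succ. Qed.

Lemma recursive_nat_rect k (f : k.-tuple nat -> nat)
    (g : nat -> nat -> k.-tuple nat -> nat) (N : k.-tuple nat -> nat) :
  recursive f ->
  recursive (fun w : k.+2.-tuple nat =>
    g (thead w) (thead (ttl w)) (ttl (ttl w))) ->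
  recursive N ->
  recursive (fun v => nat_rect (fun=> nat) (f v) (fun n r => g n r v) (N v)).
Proof.
move=> rf rg rN.
pose h (w : k.+1.-tuple nat) : nat :=
  nat_rect (fun=> nat) (f (ttl w)) (fun n r => g n r (ttl w)) (thead w).
have hE n (v : k.-tuple nat) : h [tuple of n :: v] = nat_rect (fun=> nat) (f
  v) (fun n r => g n r v) n.
  by rewrite /h ttl_cons theadE.
have rh : recursive h.
  by apply: (recursive_prim rf rg) => [v|n v];
    rewrite !hE // !theadE !ttl_cons theadE.
by apply: recursive_ext (recursive_subst rh rN) => v; rewrite hE.
Qed.

Lemma recursive_ex_min k (P : nat -> k.-tuple nat -> nat)
    (exP : forall v, exists n, P n v == 0) :
  recursive (fun w : k.+1.-tuple nat => P (thead w) (ttl w)) ->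
  recursive (fun v => ex_minn (exP v)).
Proof.
move=> rP; apply: (recursive_min rP) => [v|v n]; rewrite ttl_cons theadE;
  case: ex_minnP => m /eqP Pm minP //.
by move=> lt_nm /eqP/minP; rewrite leqNgt lt_nm.
Qed.

(** * Arithmetic functions and the numbering of finite sequences *)

Lemma recursive_add k (f g : k.-tuple nat -> nat) :
  recursive f -> recursive g -> recursive (fun v => f v + g v).
Proof.
apply: recursive_comp2.
apply: (@recursive_ext _ (fun v : 2.-tuple nat => nat_rect (fun=> nat)
  (tnth v ord0) (fun _ r => r.+1) (tnth v ord_max))) => [v|].
  by elim: (tnth v ord_max) => [|n /= ->]; rewrite ?addn0 ?addnS.
apply: (@recursive_nat_rect _ _ (fun _ r _ => r.+1)); try exact: recursive_proj.
by apply: recursive_S; apply: recursive_behead; exact: recursive_proj.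
Qed.

Lemma recursive_mul k (f g : k.-tuple nat -> nat) :
  recursive f -> recursive g -> recursive (fun v => f v * g v).
Proof.
apply: recursive_comp2.
apply: (@recursive_ext _ (fun v : 2.-tuple nat => nat_rect (fun=> nat)
  0 (fun _ r => r + tnth v ord0) (tnth v ord_max))) => [v|].
  by elim: (tnth v ord_max) => [|n /= ->]; rewrite ?muln0 ?mulnSr.
apply: (@recursive_nat_rect _ (fun=> 0) (fun _ r v => r + tnth v ord0)).
- exact: recursive_const.
- apply: recursive_add; first by apply: recursive_behead; exact: recursive_proj.
  apply: (@recursive_behead _ (fun w : 3.-tuple nat => tnth (ttl w) ord0)).
  by apply: (@recursive_behead _ (fun w : 2.-tuple nat => tnth w ord0));
    exact: recursive_proj.
- exact: recursive_proj.
Qed.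

Lemma recursive_pred k (f : k.-tuple nat -> nat) :
  recursive f -> recursive (fun v => (f v).-1).
Proof.
move=> rf; apply: (@recursive_ext _ (fun v => nat_rect (fun=> nat) 0
  (fun n _ => n) (f v))) => [v|]; first by case: (f v).
apply: (@recursive_nat_rect _ (fun=> 0) (fun n _ _ => n)) => //.
  exact: recursive_const.
exact: recursive_proj.
Qed.

Lemma recursive_sub k (f g : k.-tuple nat -> nat) :
  recursive f -> recursive g -> recursive (fun v => f v - g v).
Proof.
apply: recursive_comp2.
apply: (@recursive_ext _ (fun v : 2.-tuple nat => nat_rect (fun=> nat)
  (tnth v ord0) (fun _ r => r.-1) (tnth v ord_max))) => [v|].
  by elim: (tnth v ord_max) => [|n /= ->]; rewrite ?subn0 ?subnS.
apply: (@recursive_nat_rect _ _ (fun _ r _ => r.-1)); try exact: recursive_proj.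
by apply: recursive_pred; apply: recursive_behead; exact: recursive_proj.
Qed.

Lemma recursive_exp2 k (f : k.-tuple nat -> nat) :
  recursive f -> recursive (fun v => 2 ^ f v).
Proof.
move=> rf; apply: (@recursive_ext _ (fun v => nat_rect (fun=> nat) 1
  (fun _ r => r + r) (f v))) => [v|].
  by elim: (f v) => //= n ->; rewrite expnS mul2n addnn.
apply: (@recursive_nat_rect _ (fun=> 1) (fun _ r _ => r + r)) => //.
  exact: recursive_const.
by apply: recursive_add; apply: recursive_behead; exact: recursive_proj.
Qed.

Lemma recursive_half k (f : k.-tuple nat -> nat) :
  recursive f -> recursive (fun v => (f v)./2).
Proof.
(* The recursion is [n.+1./2 = n - n./2]. *)
move=> rf; apply: (@recursive_ext _ (fun v => nat_rect (fun=> nat) 0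
  (fun n r => n - r) (f v))) => [v|].
  elim: (f v) => //= n ->; rewrite uphalf_half.
  by rewrite -[X in X - _]odd_double_half -addnn addnA addnK.
apply: (@recursive_nat_rect _ (fun=> 0) (fun n r _ => n - r)) => //.
  exact: recursive_const.
by apply: recursive_sub; [|apply: recursive_behead]; exact: recursive_proj.
Qed.

Lemma recursive_odd k (f : k.-tuple nat -> nat) :
  recursive f -> recursive (fun v => odd (f v) : nat).
Proof.
move=> rf; apply: (@recursive_ext _ (fun v =>
  f v - ((f v)./2 + (f v)./2))) => [v|].
  by rewrite addnn -[X in X - _]odd_double_half addnK.
by apply: recursive_sub => //; apply: recursive_add; exact: recursive_half.
Qed.

Lemma recursive_iter_half k (N f : k.-tuple nat -> nat) :
  recursive N -> recursive f -> recursive (fun v => iter (N v) half (f v)).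
Proof.
move=> rN rf; apply: (@recursive_ext _ (fun v => nat_rect (fun=> nat) (f v)
  (fun _ r => r./2) (N v))) => [v|]; first by elim: (N v) => //= n ->.
apply: (@recursive_nat_rect _ _ (fun _ r _ => r./2)) => //.
by apply: recursive_half; apply: recursive_behead; exact: recursive_proj.
Qed.

(** The step of the numbering [CodeSeq.code]: a nonempty list is numbered through its head and the
    number of its tail, the empty list by 0. A pair is numbered like a list of two entries. *)
Definition code_cons a c := 2 ^ a * c.*2.+1.

Lemma iter_half_exp2 a m : iter a half (2 ^ a * m) = m.
Proof.
elim: a m => [|a IH] m; first by rewrite mul1n.
by rewrite iterSr expnS mul2n -doubleMl doubleK IH.
Qed.

Lemma code_cons_gt0 a c : 0 < code_cons a c.
Proof. by rewrite muln_gt0 expn_gt0. Qed.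

(** For positive [c] the least such [n] is the exponent of 2 in [c]. The factor [c] makes the search
    succeed for [c = 0] too, as regular minimisation demands. *)
Lemma ex_code_head c : exists n, c * (1 - odd (iter n half c)) == 0.
Proof.
case: (posnP c) => [->|c_gt0]; first by exists 0.
elim/ltn_ind: c c_gt0 => c IH c_gt0; case co: (odd c).
  by exists 0; rewrite /= co muln0.
have lt_h : c./2 < c by rewrite -divn2 ltn_Pdiv.
have h_gt0 : 0 < c./2 by case: c co c_gt0 {IH lt_h} => [|[]].
have [n] := IH _ lt_h h_gt0; rewrite muln_eq0 eqn0Ngt h_gt0 /= => /eqP E.
by exists n.+1; rewrite iterSr E muln0.
Qed.

Definition code_head c := ex_minn (ex_code_head c).
Definition code_tail c := (iter (code_head c) half c)./2.

Lemma code_consK a c : code_head (code_cons a c) = a.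
Proof.
rewrite /code_head; case: ex_minnP => m.
rewrite muln_eq0 eqn0Ngt code_cons_gt0 /= => odd_m min_m.
apply/eqP; rewrite eqn_leq min_m /=; last first.
  by rewrite iter_half_exp2 /= odd_double muln0.
rewrite leqNgt; apply: contraTN odd_m => lt_ma.
rewrite /code_cons -(subnKC lt_ma) addSnnS expnD -mulnA iter_half_exp2.
by rewrite expnS -mulnA mul2n odd_double.
Qed.

Lemma code_tail_cons a c : code_tail (code_cons a c) = c.
Proof.
by rewrite /code_tail code_consK iter_half_exp2 /= uphalf_double.
Qed.

Lemma recursive_code_cons k (f g : k.-tuple nat -> nat) :
  recursive f -> recursive g -> recursive (fun v => code_cons (f v) (g v)).
Proof.
move=> rf rg; apply: recursive_mul; first exact: recursive_exp2.
apply: recursive_S; apply: recursive_ext (recursive_add rg rg) => v.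
by rewrite addnn.
Qed.

Lemma recursive_code_head k (f : k.-tuple nat -> nat) :
  recursive f -> recursive (fun v => code_head (f v)).
Proof.
move=> rf; apply: (@recursive_ex_min _ (fun n v =>
  f v * (1 - odd (iter n half (f v))))).
apply: recursive_mul; first exact: recursive_behead.
apply: recursive_sub; first exact: recursive_const.
apply: recursive_odd; apply: recursive_iter_half; first exact: recursive_proj.
exact: recursive_behead.
Qed.

Lemma recursive_code_tail k (f : k.-tuple nat -> nat) :
  recursive f -> recursive (fun v => code_tail (f v)).
Proof.
move=> rf; apply: recursive_half; apply: recursive_iter_half => //.
exact: recursive_code_head.
Qed.

Lemma recursive_if0 k (f g h : k.-tuple nat -> nat) :
  recursive f -> recursive g -> recursive h ->
  recursive (fun v => if f v is 0 then g v else h v).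
Proof.
move=> rf rg rh; apply: (@recursive_ext _ (fun v => nat_rect (fun=> nat) (g v)
  (fun _ _ => h v) (f v))) => [v|]; first by case: (f v).
apply: (@recursive_nat_rect _ _ (fun _ _ => h)) => //.
exact: recursive_behead (recursive_behead rh).
Qed.

(** * Computable functions on countable types *)

Lemma computableP (T U : countType) (f : T -> U) :
  computable f <->
  exists2 r : nat -> nat, recursive (fun v : 1.-tuple nat => r (thead v)) &
    forall x, r (pickle x) = pickle (f x).
Proof.
split=> [[r rr rf]|[r rr rf]].
  exists (fun n => r [tuple n]); last exact: rf.
  apply: recursive_ext rr => v; case: (tupleP v) => n u.
  by rewrite (tuple0 u) theadE; congr r; exact: val_inj.
by exists (fun v => r (thead v)) => // x; rewrite -rf theadE.
Qed.

Lemma pickle_cons (T : countType) (x : T) s :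
  pickle (x :: s) = code_cons (pickle x) (pickle s).
Proof. by []. Qed.

Lemma pickle_pair (T U : countType) (x : T) (y : U) :
  pickle (x, y) = code_cons (pickle x) (code_cons (pickle y) 0).
Proof. by []. Qed.

Section Combinators.
Variables (T U V : countType).
Implicit Types (f : T -> U) (g : T -> V).

Lemma computable_ext f f' : f =1 f' -> computable f -> computable f'.
Proof. by move=> /funext->. Qed.

Lemma computable_id : computable (@id T).
Proof. by apply/computableP; exists id => //; exact: recursive_proj. Qed.

Lemma computable_cst (c : U) : computable (fun _ : T => c).
Proof. by apply/computableP; exists (fun=> pickle c) => //;
  exact: recursive_const. Qed.

Lemma computable_comp f (g : U -> V) :
  computable f -> computable g -> computable (fun x => g (f x)).
Proof.
move=> /computableP[r rr rf] /computableP[s rs sg]; apply/computableP.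
exists (fun n => s (r n)) => [|x]; last by rewrite rf sg.
exact: recursive_comp1 rs rr.
Qed.

Lemma computable_pair f g :
  computable f -> computable g -> computable (fun x => (f x, g x)).
Proof.
move=> /computableP[r rr rf] /computableP[s rs sg]; apply/computableP.
exists (fun n => code_cons (r n) (code_cons (s n) 0)) => [|x].
  by do !apply: recursive_code_cons => //; exact: recursive_const.
by rewrite rf sg pickle_pair.
Qed.

Lemma computable_fst (f : T -> U * V) : computable f ->
  computable (fun x => (f x).1).
Proof.
move=> /computableP[r rr rf]; apply/computableP;
  exists (fun n => code_head (r n)).
  exact: recursive_code_head.
by move=> x; rewrite rf; case: (f x) => a b; rewrite pickle_pair code_consK.
Qed.

Lemma computable_snd (f : T -> U * V) : computable f ->
  computable (fun x => (f x).2).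
Proof.
move=> /computableP[r rr rf]; apply/computableP.
exists (fun n => code_head (code_tail (r n))).
  by apply: recursive_code_head; exact: recursive_code_tail.
by move=> x; rewrite rf; case: (f x) => a b;
  rewrite pickle_pair code_tail_cons code_consK.
Qed.

Lemma computable_pickle f : computable f -> computable (fun x => pickle (f x)).
Proof. by move=> /computableP[r rr rf]; apply/computableP; exists r. Qed.

Lemma computable_succ (f : T -> nat) : computable f ->
  computable (fun x => (f x).+1).
Proof.
move=> /computableP[r rr rf]; apply/computableP; exists (fun n => (r n).+1).
  exact: recursive_S.
by move=> x; rewrite rf.
Qed.

Lemma computable_double (f : T -> nat) : computable f ->
  computable (fun x => (f x).*2).
Proof.
move=> /computableP[r rr rf]; apply/computableP; exists (fun n => r n + r n).
  exact: recursive_add.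
by move=> x; rewrite rf -addnn.
Qed.

Lemma computable_if (b : T -> bool) f f' : computable b -> computable f ->
  computable f' -> computable (fun x => if b x then f x else f' x).
Proof.
move=> /computableP[r rr rb] /computableP[s rs sf] /computableP[s' rs' sf'].
apply/computableP; exists (fun n => if r n is 0 then s' n else s n).
  exact: recursive_if0.
by move=> x; rewrite rb; case: (b x); rewrite /= (sf, sf').
Qed.

Lemma computable_eq f f' : computable f -> computable f' ->
  computable (fun x => f x == f' x).
Proof.
move=> /computableP[r rr rf] /computableP[s rs sf]; apply/computableP.
exists (fun n => 1 - ((r n - s n) + (s n - r n))).
  apply: recursive_sub; first exact: recursive_const.
  by apply: recursive_add; exact: recursive_sub.
move=> x; rewrite rf sf -(inj_eq (pcan_inj pickleK)).
move: (pickle (f x)) (pickle (f' x)) => m n.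
case: ltngtP => [lt|lt|->]; last by rewrite subnn.
  by rewrite (eqP (ltnW lt)) add0n; move: lt; rewrite -subn_gt0; case: (n - m).
by rewrite addnC (eqP (ltnW lt)) add0n; move: lt; rewrite -subn_gt0;
  case: (m - n).
Qed.

Lemma computable_cons f (s : T -> seq U) : computable f -> computable s ->
  computable (fun x => f x :: s x).
Proof.
move=> /computableP[r rr rf] /computableP[q rq qs]; apply/computableP.
exists (fun n => code_cons (r n) (q n)); first exact: recursive_code_cons.
by move=> x; rewrite rf qs pickle_cons.
Qed.

(** On numbers the case split is a test for zero, because [code_cons] is always positive. *)
Lemma computable_seq_case (s : T -> seq U) (g : T ->
  V) (h : T * (U * seq U) -> V) :
  computable s -> computable g -> computable h ->
  computable (fun x => if s x is y :: s' then h (x, (y, s')) else g x).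
Proof.
move=> /computableP[r rr rs] /computableP[q rq qg] /computableP[p rp ph].
apply/computableP; exists (fun n => if r n is 0 then q n else p
  (code_cons n (code_cons (code_cons (code_head (r n)) (code_cons (code_tail
    (r n)) 0)) 0))).
  apply: recursive_if0 => //; apply: recursive_comp1 rp _.
  apply: recursive_code_cons; first exact: recursive_proj.
  apply: recursive_code_cons; last exact: recursive_const.
  apply: recursive_code_cons; first exact: recursive_code_head.
  apply: recursive_code_cons; last exact: recursive_const.
  exact: recursive_code_tail.
move=> x; rewrite rs; case: (s x) => [|y s'] /=; first exact: qg.
rewrite -ph !pickle_pair pickle_cons code_consK code_tail_cons.
by case: (code_cons _ _) (code_cons_gt0 (pickle y) (pickle s')).
Qed.

Lemma computable_nat_rect (f : T -> U) (g : T * (nat * U) -> U) (N : T -> nat) :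
  computable f -> computable g -> computable N ->
  computable (fun x => nat_rect (fun=> U) (f x) (fun n r =>
    g (x, (n, r))) (N x)).
Proof.
move=> /computableP[r rr rf] /computableP[q rq qg] /computableP[p rp pN].
apply/computableP; exists (fun v => nat_rect (fun=> nat) (r v)
  (fun n y => q (code_cons v (code_cons (code_cons n (code_cons y 0)) 0))) (p
    v)).
  apply: (@recursive_nat_rect 1 (fun v => r (thead v)) (fun n y v =>
    q (code_cons
    (thead v) (code_cons (code_cons n (code_cons y 0)) 0))) (fun v =>
      p (thead v))) => //.
  apply: recursive_comp1 rq _.
  apply: recursive_code_cons.
    apply: (recursive_behead (f := fun w : 2.-tuple nat => thead (ttl w))).
    by apply: (recursive_behead (f := fun w : 1.-tuple nat => thead w));
      exact: recursive_proj.
  apply: recursive_code_cons; last exact: recursive_const.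
  apply: recursive_code_cons; first exact: recursive_proj.
  apply: recursive_code_cons; last exact: recursive_const.
  by apply: (recursive_behead (f := fun w : 2.-tuple nat => thead w));
    exact: recursive_proj.
move=> x; rewrite pN /=; elim: (N x) => /= [|n ->]; first exact: rf.
by rewrite -qg !pickle_pair.
Qed.

End Combinators.

(* Minimisation must succeed on all numbers, also on those that encode nothing;
   [D] sends the latter to some element of [T]. *)
Definition effective (T : countType) : Prop :=
  exists2 D : nat -> T, computable D & cancel pickle D.

Lemma computable_search (T : countType) (P : T * nat -> bool)
    (exP : forall x, exists n, P (x, n)) :
  effective T -> computable P -> computable (fun x => ex_minn (exP x)).
Proof.
move=> [D /computableP[d rd dD] DK] /computableP[p rp pP]; apply/computableP.
(* The parameter is first normalised to [d v], the number of an actual element, for which a witness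
   exists. *)
have pE v n : p (code_cons (d v) (code_cons n 0)) = P (D v, n).
  by rewrite [d v](dD v); exact: (pP (D v, n)).
have exp v : exists n, 1 - p (code_cons (d (thead (v : 1.-tuple nat)))
  (code_cons n 0)) == 0.
  by have [n Pn] := exP (D (thead v)); exists n; rewrite pE Pn.
have rm : recursive (fun v => ex_minn (exp v)).
  apply: (@recursive_ex_min 1 (fun n v =>
    1 - p (code_cons (d (thead v)) (code_cons n 0)))).
  apply: recursive_sub; first exact: recursive_const.
  apply: recursive_comp1 rp _; apply: recursive_code_cons.
    by apply: (recursive_behead (f := fun w : 1.-tuple nat => d (thead w))).
  by apply: recursive_code_cons;
    [exact: recursive_proj | exact: recursive_const].
exists (fun n => ex_minn (exp [tuple n])).
  by apply: recursive_ext rm => v; apply: eq_ex_minn => m; rewrite theadE.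
move=> x; apply: (@eq_ex_minn) => n; rewrite theadE pE DK.
by case: (P _).
Qed.

Ltac computability_step :=
  match goal with
  | H : computable _ |- _ => exact H
  | |- computable fst => apply: (@computable_fst _ _ _ id)
  | |- computable snd => apply: (@computable_snd _ _ _ id)
  | |- computable (@id _) => exact: computable_id
  | |- computable (fun x => x) => exact: computable_id
  | |- computable (fun x => (_, _)) => apply: computable_pair
  | |- computable (fun x => (@?f x).1) => apply: (@computable_fst _ _ _ f)
  | |- computable (fun x => (@?f x).2) => apply: (@computable_snd _ _ _ f)
  | |- computable (fun x => (@?f x).+1) => apply: (@computable_succ _ f)
  | |- computable (fun x => (@?f x).*2) => apply: (@computable_double _ f)
  | |- computable (fun x => pickle (@?f x)) => apply: (@computable_pickle _ _ f)
  | |- computable (fun x => @?f x == @?g x) => apply: (@computable_eq _ _ f g)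
  | |- computable (fun x => @?f x :: @?g x) => apply: (@computable_cons _ _ f g)
  | |- computable (fun x => if _ then _ else _) => apply: computable_if
  | |- computable (fun x => ?c) => exact: computable_cst
  end.
Ltac computability := repeat computability_step.

(** Supplies a recursion bound for folds: the number of a list is at hand, its length is not. *)
Lemma size_pickle (T : countType) (s : seq T) : size s <= pickle s.
Proof.
elim: s => //= x s IH; rewrite pickle_cons /code_cons.
rewrite (leq_trans (n := (pickle s).*2.+1)) ?ltnS ?leq_pmull ?expn_gt0 //.
by rewrite -addnn (leq_trans IH) ?leq_addr.
Qed.

(** * Computable operations on lists *)

Section ListCombinators.
Variables (T U V : countType).

(** The fold is run for [pickle (s x)] rounds on pairs of an accumulator and the unread part of the
    list; once the list is used up, the surplus rounds change nothing. *)
Lemma computable_foldl (f : T -> V) (g : T -> V -> U -> V) (s : T -> seq U) :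
  computable f -> computable (fun p : T * (V * U) => g p.1 p.2.1 p.2.2) ->
  computable s -> computable (fun x => foldl (g x) (f x) (s x)).
Proof.
move=> cf cg cs.
pose step x (_ : nat) (r : V * seq U) :=
  if r.2 is y :: s' then (g x r.1 y, s') else (r.1, [::]).
have cstep : computable (fun p : T * (nat * (V * seq U)) =>
  step p.1 p.2.1 p.2.2).
  pose h (q : (T * (nat * (V * seq U))) * (U * seq U)) :=
    (g q.1.1 q.1.2.2.1 q.2.1, q.2.2).
  apply: (@computable_seq_case _ _ _ (fun p => p.2.2.2) (fun p =>
    (p.2.2.1, [::])) h);
    try by computability.
  apply: computable_pair; last by computability.
  apply: (computable_comp (f :=
    fun q : (T * (nat * (V * seq U))) * (U * seq U) =>
     (q.1.1, (q.1.2.2.1, q.2.1))) _ cg); computability.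
apply: (@computable_ext _ _ (fun x =>
  (nat_rect (fun=> (V * seq U)%type) (f x, s x)
    (step x) (pickle (s x))).1)) => [x|]; last first.
  apply: computable_fst.
  by apply: (@computable_nat_rect _ _ _ (fun p => step p.1 p.2.1 p.2.2));
    computability.
suff H n : forall v t, size t <= n ->
  nat_rect (fun=> (V * seq U)%type) (v, t) (step x) n = (foldl (g x) v t, [::]).
  by rewrite H ?size_pickle.
have iterE v t : nat_rect (fun=> (V * seq U)%type) (v,
  t) (step x) n = iter n (step x 0) (v, t).
  by elim: n => //= n ->.
move=> v t; rewrite iterE {iterE}; elim: n v t => [|n IH] v [|y t] // le_tn;
  rewrite iterSr; first exact: (IH v [::]).
exact: IH.
Qed.

End ListCombinators.

Section ListCombinators2.
Variables (T U V : countType).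

Lemma computable_catrev (s t : T -> seq U) : computable s -> computable t ->
  computable (fun x => catrev (s x) (t x)).
Proof.
move=> cs ct.
apply: (@computable_ext _ _ (fun x => foldl (fun v u =>
  u :: v) (t x) (s x))) => [x|].
  by elim: (s x) (t x) => //= y s' IH t'; rewrite IH.
apply: (@computable_foldl _ _ _ t (fun _ v u => u :: v) s); computability.
Qed.

Lemma computable_rev (s : T -> seq U) : computable s ->
  computable (fun x => rev (s x)).
Proof. by move=> cs; apply: computable_catrev; computability. Qed.

Lemma computable_foldr (f : T -> V) (g : T -> U -> V -> V) (s : T -> seq U) :
  computable f -> computable (fun p : T * (U * V) => g p.1 p.2.1 p.2.2) ->
  computable s -> computable (fun x => foldr (g x) (f x) (s x)).
Proof.
move=> cf cg cs.
apply: (@computable_ext _ _ (fun x => foldl (fun v u =>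
  g x u v) (f x) (rev (s x)))) => [x|].
  by rewrite foldl_rev.
apply: (@computable_foldl _ _ _ f (fun x v u => g x u v)) => //;
  last exact: computable_rev.
apply: (computable_comp (f :=
  fun q : T * (V * U) => (q.1, (q.2.2, q.2.1))) _ cg).
computability.
Qed.

Lemma computable_cat (s t : T -> seq U) : computable s -> computable t ->
  computable (fun x => s x ++ t x).
Proof.
move=> cs ct.
apply: (@computable_ext _ _ (fun x => catrev (rev (s x)) (t x))) => [x|].
  by rewrite catrevE revK.
exact/computable_catrev/ct/computable_rev.
Qed.

End ListCombinators2.

Lemma computable_map (T U V : countType) (f : T -> U -> V) (s : T -> seq U) :
  computable (fun p : T * U => f p.1 p.2) -> computable s ->
  computable (fun x => [seq f x y | y <- s x]).
Proof.
move=> cf cs.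
apply: (@computable_ext _ _ (fun x => rev (foldl (fun v u =>
  f x u :: v) [::] (s x)))) => [x|].
  rewrite -[RHS]cat0s -[[::] in RHS]/(rev [::]);
    elim: (s x) [::] => [|y t IH] r /=.
    by rewrite cats0.
  by rewrite IH rev_cons cat_rcons.
apply: computable_rev.
apply: (@computable_foldl _ _ _ (fun=> [::]) (fun x v u => f x u :: v));
  computability.
by apply: (computable_comp (f :=
  fun q : T * (seq V * U) => (q.1, q.2.2)) _ cf); computability.
Qed.


Section ListCombinators3.
Variables (T U : countType).

Lemma computable_flatten (s : T -> seq (seq U)) : computable s ->
  computable (fun x => flatten (s x)).
Proof.
move=> cs; apply: (@computable_foldr _ _ _ (fun=> [::]) (fun _ u v =>
  u ++ v)) => //.
  exact: computable_cst.
by apply: computable_cat; computability.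
Qed.

Lemma computable_filter (P : T -> U -> bool) (s : T -> seq U) :
  computable (fun p : T * U => P p.1 p.2) -> computable s ->
  computable (fun x => [seq y <- s x | P x y]).
Proof.
move=> cP cs.
apply: (@computable_ext _ _ (fun x => foldr (fun y r =>
  if P x y then y :: r else r) [::] (s x))) => [x|].
  by elim: (s x) => //= y t ->.
apply: (@computable_foldr _ _ _ (fun=> [::]) (fun x y r =>
  if P x y then y :: r else r)) => //;
  computability.
by apply: (computable_comp (f :=
  fun q : T * (U * seq U) => (q.1, q.2.1)) _ cP); computability.
Qed.

Lemma computable_has (P : T -> U -> bool) (s : T -> seq U) :
  computable (fun p : T * U => P p.1 p.2) -> computable s ->
  computable (fun x => has (P x) (s x)).
Proof.
move=> cP cs.
apply: (@computable_ext _ _ (fun x => foldr (fun y r =>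
  if P x y then true else r) false (s x))) => [x|].
  by elim: (s x) => //= y t ->; case: (P x y).
apply: (@computable_foldr _ _ _ (fun=> false) (fun x y r =>
  if P x y then true else r)) => //;
  computability.
by apply: (computable_comp (f :=
  fun q : T * (U * bool) => (q.1, q.2.1)) _ cP); computability.
Qed.

Lemma computable_negb (b : T -> bool) : computable b ->
  computable (fun x => ~~ b x).
Proof.
move=> cb; apply: (@computable_ext _ _ (fun x =>
  if b x then false else true)) => [x|].
  by case: (b x).
computability.
Qed.

Lemma computable_andb (b c : T -> bool) : computable b -> computable c ->
  computable (fun x => b x && c x).
Proof.
move=> cb cc; apply: (@computable_ext _ _ (fun x =>
  if b x then c x else false)) => [x|].
  by case: (b x).
computability.
Qed.

Lemma computable_orb (b c : T -> bool) : computable b -> computable c ->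
  computable (fun x => b x || c x).
Proof.
move=> cb cc; apply: (@computable_ext _ _ (fun x =>
  if b x then true else c x)) => [x|].
  by case: (b x).
computability.
Qed.

Lemma computable_all (P : T -> U -> bool) (s : T -> seq U) :
  computable (fun p : T * U => P p.1 p.2) -> computable s ->
  computable (fun x => all (P x) (s x)).
Proof.
move=> cP cs.
apply: (@computable_ext _ _ (fun x => foldr (fun y r =>
  if P x y then r else false) true (s x))) => [x|].
  by elim: (s x) => //= y t ->; case: (P x y).
apply: (@computable_foldr _ _ _ (fun=> true) (fun x y r =>
  if P x y then r else false)) => //;
  computability.
by apply: (computable_comp (f :=
  fun q : T * (U * bool) => (q.1, q.2.1)) _ cP); computability.
Qed.

Lemma computable_mem (f : T -> U) (s : T -> seq U) : computable f ->
  computable s ->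
  computable (fun x => f x \in s x).
Proof.
move=> cf cs; apply: (@computable_ext _ _ (fun x => has (fun y =>
  f x == y) (s x))) => [x|].
  by rewrite -has_pred1; apply: eq_has => y; rewrite /= eq_sym.
apply: (@computable_has (fun x y => f x == y)) => //; computability.
by apply: (computable_comp (f := fst) _ cf); computability.
Qed.

Lemma computable_behead (s : T -> seq U) : computable s ->
  computable (fun x => behead (s x)).
Proof.
move=> cs; apply: (@computable_ext _ _ (fun x =>
  if s x is y :: s' then (x, (y, s')).2.2 else [::])) => [x|].
  by case: (s x).
apply: (@computable_seq_case _ _ _ s _ (fun p => p.2.2)); computability.
Qed.

Lemma computable_head (x0 : U) (s : T -> seq U) : computable s ->
  computable (fun x => head x0 (s x)).
Proof.
move=> cs; apply: (@computable_ext _ _ (fun x =>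
  if s x is y :: s' then (x, (y, s')).2.1 else x0)) => [x|].
  by case: (s x).
apply: (@computable_seq_case _ _ _ s _ (fun p => p.2.1)); computability.
Qed.

End ListCombinators3.

Lemma computable_nth (T U : countType) (x0 : U) (s : T -> seq U) (n : T ->
  nat) :
  computable s -> computable n -> computable (fun x => nth x0 (s x) (n x)).
Proof.
move=> cs cn.
apply: (@computable_ext _ _ (fun x => head x0 (nat_rect (fun=> seq U) (s x)
    (fun _ r => behead r) (n x)))) => [x|].
  rewrite -nth0 -[n x]addn0 -[in RHS](addn0 (n x)) -nth_drop; congr nth.
  rewrite addn0; elim: (n x) => [|m /= ->]; first by rewrite drop0.
  by rewrite -drop1 drop_drop.
apply: computable_head.
apply: (@computable_nat_rect _ _ _ (fun p => behead p.2.2)) => //.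
by apply: computable_behead; computability.
Qed.

(** A cascade of equality tests along [enum T] selects the program. As [T] is finite, the programs
    need not depend on [t] in a computable way. *)
Lemma computable_finType_case (T : finType) (S U : countType) (f : T ->
  S -> U) :
  (forall t, computable (f t)) -> computable (fun p : T * S => f p.1 p.2).
Proof.
move=> cf.
case: (pickP (mem T)) => [t0 _|T0]; last first.
  by apply/computableP; exists id => [|[t]];
    [exact: recursive_proj|have := T0 t].
suff [g cg gf] : exists2 g : T * S -> U, computable g &
    forall p, p.1 \in enum T -> g p = f p.1 p.2.
  by apply: computable_ext cg => p; rewrite gf ?mem_enum.
elim: (enum T) => [|y s [g cg gf]].
  exists (fun p => f t0 p.2) => //.
  by apply: (computable_comp (f := snd) _ (cf t0)); computability.
exists (fun p => if p.1 == y then f y p.2 else g p).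
  by apply: computable_if => //; computability;
    apply: (computable_comp (f := snd) _ (cf y)); computability.
by move=> p; rewrite inE; case: eqP => [<-|_ /gf].
Qed.

(** * Types with a total decoding, over which one can search *)

Lemma effective_nat : effective nat.
Proof. by exists id => //; exact: computable_id. Qed.

Lemma effective_finType (T : finType) (x0 : T) : effective T.
Proof.
pose D s (n : nat) := foldr (fun t d => if n == pickle t then t else d) x0 s.
exists (D (enum T)) => [|x].
  elim: (enum T) => [|y s IH]; rewrite /D /=; first exact: computable_cst.
  by apply: computable_if IH; computability.
have : x \in enum T by rewrite mem_enum.
rewrite /D; elim: (enum T) => //= y s IH;
  rewrite inE (inj_eq (pcan_inj pickleK)).
by case: eqP => [->|].
Qed.

(** On numbers this is the identity: a list of numbers is pickled by [CodeSeq.code], which inverts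
    [decode]. It lets a search over numbers be a search over lists. *)
Lemma computable_decode : computable CodeSeq.decode.
Proof.
apply/computableP; exists id => [|n]; first exact: recursive_proj.
by rewrite /pickle /= /pickle_seq map_id CodeSeq.decodeK.
Qed.

Lemma effective_seq (T : countType) : effective T -> effective (seq T).
Proof.
move=> [D cD DK]; exists (fun n => map D (CodeSeq.decode n)).
  apply: (@computable_map _ _ _ (fun _ m => D m));
    last exact: computable_decode.
  by apply: (computable_comp (f := snd) _ cD); computability.
by move=> s; have -> : pickle s = CodeSeq.code (map pickle s) by [];
  rewrite CodeSeq.codeK -map_comp map_id_in // => x _; exact: DK.
Qed.

Lemma effective_prod (T U : countType) : effective T -> effective U ->
  effective (T * U)%type.
Proof.
move=> [D cD DK] [E cE EK].
exists (fun n => (D (nth 0 (CodeSeq.decode n) 0),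
  E (nth 0 (CodeSeq.decode n) 1))).
  have cdec := computable_decode.
  by apply: computable_pair;
    [apply: computable_comp cD|apply: computable_comp cE];
    apply: computable_nth; computability.
by case=> x y; have -> : pickle (x, y) = CodeSeq.code [:: pickle x;
  pickle y] by []; rewrite CodeSeq.codeK /= DK EK.
Qed.

Lemma effective_fsa (L : countType) : effective L -> effective (fsa L).
Proof.
move=> eL; have en := effective_nat.
have := effective_prod (effective_prod (effective_seq en) (effective_seq
  (effective_prod
  (effective_prod en eL) en))) (effective_seq en).
case=> D /computableP[d rd dD] DK; exists (fun n => fsa_of_prod (D n)).
  by apply/computableP; exists d => // n; rewrite dD; case: (D n) => -[].
by move=> M; rewrite [pickle M]/(pickle (fsa_to_prod M)) DK fsa_to_prodK.
Qed.

(** * Britton's lemma *)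

Section Britton.
Local Open Scope group_scope.
Variables (G : groupType) (dom : bool -> set G) (f : bool -> G -> G).
Hypothesis dom_group : forall e, is_subgroup (dom e).
Hypothesis f_dom : forall e x, dom e x -> dom (~~ e) (f e x).
Hypothesis fM : forall e x y, dom e x -> dom e y -> f e (x * y) = f e x * f e y.
Hypothesis fK : forall e x, dom e x -> f (~~ e) (f e x) = x.

Lemma subgroup1 (H : set G) : is_subgroup H -> H 1.
Proof. by case=> /set_mem. Qed.

Lemma subgroupF (H : set G) x y : is_subgroup H -> H x -> H y -> H (x * y^-1).
Proof. by case=> _ cl Hx Hy; apply/set_mem/cl; exact/mem_set. Qed.

Lemma subgroupV (H : set G) x : is_subgroup H -> H x -> H x^-1.
Proof. by move=> sH Hx; rewrite -[x^-1]mul1g; apply: subgroupF => //;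
  exact: subgroup1. Qed.

Lemma subgroupM (H : set G) x y : is_subgroup H -> H x -> H y -> H (x * y).
Proof. by move=> sH Hx Hy; rewrite -[y]invgK; apply: subgroupF => //;
  exact: subgroupV. Qed.

Lemma subgroupMr (H : set G) x y : is_subgroup H -> H y -> H (x * y) <-> H x.
Proof.
move=> sH Hy; split=> [Hxy|Hx]; last exact: subgroupM.
by rewrite -[x](mulgK y); apply: subgroupF.
Qed.

Lemma assoc_map1 e : f e 1 = 1.
Proof.
apply: (mulgI (f e 1)); rewrite -fM ?mulg1 //; exact: subgroup1.
Qed.

Lemma assoc_mapV e x : dom e x -> f e x^-1 = (f e x)^-1.
Proof.
move=> dx; apply: (mulgI (f e x)); rewrite -fM ?mulgV ?assoc_map1 //;
  exact: subgroupV.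
Qed.

Lemma assoc_mapKV e x : dom (~~ e) x -> f e (f (~~ e) x) = x.
Proof. by move=> dx; rewrite -{1}[e]negbK fK. Qed.

(* A list [l] of syllables [(e, g)], last syllable first, stands for the product
   of the [g t^e], with [t^-1] for [e = false].  [syl_eqv c l l'] witnesses that
   multiplying the product of [l] by [c] gives the product of [l']. *)
Fixpoint syl_eqv (c : G) (l l' : seq (bool * G)) : Prop :=
  match l, l' with
  | [::], [::] => c = 1
  | (e, g) :: k, (e', g') :: k' =>
      e = e' /\ exists a, [/\ dom e a, c = f e a & syl_eqv (g * a * g'^-1) k k']
  | _, _ => False
  end.

Lemma syl_eqv_refl l : syl_eqv 1 l l.
Proof.
elim: l => //= -[e g] k IH; split=> //; exists 1.
by rewrite assoc_map1 mulg1 mulgV; split=> //; exact: subgroup1.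
Qed.

Lemma syl_eqv_sym c l l' : syl_eqv c l l' -> syl_eqv c^-1 l' l.
Proof.
elim: l c l' => [|[e g] k IH] c [|[e' g'] k'] //=; first by move=> ->;
  rewrite invg1.
move=> [<- [a [da -> /IH E]]]; split=> //; exists a^-1; split;
  first exact: subgroupV.
  by rewrite assoc_mapV.
by move: E; rewrite !invgM invgK mulgA.
Qed.

Lemma syl_eqv_trans c d l1 l2 l3 :
  syl_eqv c l1 l2 -> syl_eqv d l2 l3 -> syl_eqv (c * d) l1 l3.
Proof.
elim: l1 c d l2 l3 => [|[e g] k IH] c d [|[e' g'] k'] [|[e'' g''] k''] //=.
  by move=> -> ->; rewrite mulg1.
move=> [<- [a [da -> E1]]] [<- [b [db -> E2]]]; split=> //; exists (a * b).
split; [exact: subgroupM | by rewrite fM |].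
by have := IH _ _ _ _ E1 E2; rewrite !mulgA mulgVK.
Qed.

(** A state [(g, l)] stands for the product of [l] times [g]. The associated subgroups are treated
    alike: [dom e] is the one with [x t^e = t^e (f e x)], so a pinch [t^-e x t^e] is replaced by
    [f e x]. States are compared up to [nf_eqv] instead of being made unique by coset
    representatives. *)
Definition nf_push (s : G * seq (bool * G)) (x : G + bool) : G * seq (bool *
  G) :=
  match x with
  | inl h => (s.1 * h, s.2)
  | inr e =>
      if s.2 is (e', g) :: k then
        if (e' == ~~ e) && `[< dom e s.1 >] then (g * f e s.1, k)
        else (1, (e, s.1) :: s.2)
      else (1, (e, s.1) :: s.2)
  end.

Fixpoint syl_reduced (l : seq (bool * G)) : Prop :=
  if l is (e, g) :: k then
    (if k is (e', _) :: _ then ~ (e' = ~~ e /\ dom e g) else True) /\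
      syl_reduced k
  else True.

Definition nf_eqv (s s' : G * seq (bool * G)) :=
  syl_eqv (s.1 * s'.1^-1) s.2 s'.2.

Lemma nf_push_reduced s x : syl_reduced s.2 -> syl_reduced (nf_push s x).2.
Proof.
case: s x => g l [h|e] //=; case: l => [|[e' g'] k] //=.
case: ifP => [_ []//|/negbT]; rewrite negb_and => H rl /=; split=> // -[Ee dg].
by case/orP: H => [/eqP//|/negP]; apply; exact/asboolP.
Qed.

Lemma nf_push_reduced_seq u s : syl_reduced s.2 ->
  syl_reduced (foldl nf_push s u).2.
Proof. by elim: u s => //= x u IH s rs; apply: IH; exact: nf_push_reduced. Qed.

(** If both states end in [t^-e] before their tails [g] and [g'], equivalence puts [g * g'^-1] into
    [dom e]. Hence [g] lies in [dom e] if and only if [g'] does, and the letter [t^e] cancels in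
    both states or in neither. *)
Lemma nf_push_eqv x s s' : nf_eqv s s' -> nf_eqv (nf_push s x) (nf_push s' x).
Proof.
case: s s' x => [g l] [g' l'] [h|e]; rewrite /nf_eqv /=.
  by rewrite invgM mulgA mulgK.
have cons k k' : syl_eqv (g * g'^-1) k k' ->
    syl_eqv (1 * 1^-1) ((e, g) :: k) ((e, g') :: k').
  move=> E; split=> //; exists 1; rewrite assoc_map1 mulg1 mulgV; split=> //.
  exact: subgroup1.
case: l l' => [|[e1 g1] k] [|[e1' g1'] k'] E; try by [case: E|apply: cons].
have ee : e1 = e1' by case: E.
rewrite -{e1'}ee in E *; have [_ [a [da Ea Ek]]] := E.
case: eqP => [E1|_]; last by apply: (cons (_ :: _) (_ :: _)).
rewrite E1 in da Ea E.
have da' : dom e (g * g'^-1) by rewrite Ea -{1}[e]negbK; exact: f_dom.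
have dV : dom e g <-> dom e g'.
  have {1}-> : g = (g * g'^-1) * g' by rewrite mulgVK.
  split=> d; last exact: subgroupM.
  by rewrite -[g'](mulKg (g * g'^-1)); apply: subgroupM => //; exact: subgroupV.
rewrite -(asbool_equiv_eq dV) /=; case: asboolP => dg; last by apply: cons;
  rewrite E1.
have dg' : dom e g' by exact/dV.
rewrite /= invgM -assoc_mapV // mulgA -(mulgA g1) -fM //; last exact: subgroupV.
by rewrite Ea -{1}[e]negbK fK.
Qed.

Lemma nf_push_eqv_seq u s s' : nf_eqv s s' ->
  nf_eqv (foldl nf_push s u) (foldl nf_push s' u).
Proof. by elim: u s s' => //= x u IH s s' E; apply: IH; exact: nf_push_eqv. Qed.

Lemma nf_eqv_refl s : nf_eqv s s.
Proof. by rewrite /nf_eqv mulgV; exact: syl_eqv_refl. Qed.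

Lemma nf_eqv_sym s s' : nf_eqv s s' -> nf_eqv s' s.
Proof. by move=> /syl_eqv_sym; rewrite invgM invgK. Qed.

Lemma nf_eqv_trans s2 s1 s3 : nf_eqv s1 s2 -> nf_eqv s2 s3 -> nf_eqv s1 s3.
Proof. by move=> E1 E2; have := syl_eqv_trans E1 E2; rewrite mulgA mulgVK. Qed.

Let A := dom true.
Let phi := f true.

(** The delicate case is a first letter that cancels the last syllable, so that the next one has to
    restore it. If that letter cancelled as well, [l] would already contain a pinch, because the
    factor picked up meanwhile lies in the associated subgroup; reducedness excludes this. *)
Lemma nf_push_relator r q s : syl_reduced s.2 -> hnn_relator A phi r q ->
  nf_eqv (foldl nf_push s r) (foldl nf_push s q).
Proof.
case: s => g l rl rq; case: rq rl => [|h h'|b|a Aa] rl /=.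
- by rewrite mulg1; exact: nf_eqv_refl.
- by rewrite mulgA; exact: nf_eqv_refl.
- have nocancel k : nf_eqv (nf_push (1, (b, g) :: k) (inr (~~ b))) (g, k).
    rewrite /= negbK eqxx /=; case: asboolP => [_|[]]; last exact: subgroup1.
    by rewrite assoc_map1 mulg1; exact: nf_eqv_refl.
  case: l rl => [|[e g1] k] /= rl; first exact: nocancel.
  case: ifP => [/andP[/eqP ee /asboolP dg]|_]; last exact: nocancel.
  subst e; rewrite /=; have df := f_dom dg.
  have ndf : ~ dom (~~ b) g1 -> ~ dom (~~ b) (g1 * f b g).
    by move=> nd /(subgroupMr g1 (dom_group _) df).
  case: k rl => [|[e2 g2] k] rl /=.
    (* The witness moves [g^-1] back across the restored letter. *)
    rewrite /nf_eqv /=; split=> //; exists (f b g^-1); split.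
    - by apply: f_dom; exact: subgroupV.
    - by rewrite fK ?mul1g //; exact: subgroupV.
    - by rewrite -(mulgA g1) -fM ?mulgV ?assoc_map1 ?mulg1 ?mulgV //;
      exact: subgroupV.
  case: ifP => [/andP[/eqP Ee /asboolP d]|_].
    case: rl => ne _; exfalso; apply: ne; split; first exact: Ee.
    by apply: contrapT => nd; exact: ndf nd d.
  rewrite /nf_eqv; split=> //; exists (f b g^-1); split.
  - by apply: f_dom; exact: subgroupV.
  - by rewrite fK ?mul1g //; exact: subgroupV.
  - rewrite /= -(mulgA g1) -fM ?mulgV ?assoc_map1 ?mulg1 ?mulgV //;
    last exact: subgroupV.
    by split=> //; exact: (syl_eqv_refl ((e2, g2) :: k)).2.
- have nocancel k : nf_eqv (nf_push (1 * a, (false,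
  g) :: k) (inr true)) (g * phi a, k).
    by rewrite mul1g /=; case: asboolP => // _; exact: nf_eqv_refl.
  case: l rl => [|[e g1] k] /= rl; first exact: nocancel.
  case: ifP => [/andP[/eqP ee /asboolP dg] /=|_]; last exact: nocancel.
  subst e; have dfa : dom true (f false g * a).
    by apply: subgroupM => //; exact: (f_dom (e := false)).
  have main : nf_eqv (1, (true, g1 * f false g * a) :: k) (g * phi a, (true,
    g1) :: k).
    rewrite /nf_eqv; split=> //; exists (f false g * a)^-1; split.
    - exact: subgroupV.
    - rewrite assoc_mapV // fM //; last exact: (f_dom (e := false)).
      by rewrite (assoc_mapKV (e := true)) // mul1g.
    - by rewrite -(mulgA g1) mulgK mulgV; exact: syl_eqv_refl.
  case: k rl main => [|[e2 g2] k] //= rl main.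
  case: ifP => // /andP[/eqP Ee /asboolP d]; case: rl => -[]; split=> //.
  by move: d; rewrite -mulgA => /(subgroupMr g1 (dom_group _) dfa).
Qed.

Lemma nf_push_hnn_equiv u v s : hnn_equiv A phi u v -> syl_reduced s.2 ->
  nf_eqv (foldl nf_push s u) (foldl nf_push s v).
Proof.
move=> uv; elim: uv s => {u v}[u v r q rq|u|u v _ IH|v u w _ IH1 _ IH2] s rs.
- rewrite !foldl_cat; apply: nf_push_eqv_seq; apply: nf_push_relator => //.
  exact: nf_push_reduced_seq.
- exact: nf_eqv_refl.
- exact/nf_eqv_sym/IH.
- exact: nf_eqv_trans (IH1 _ rs) (IH2 _ rs).
Qed.

Fixpoint syl_word (l : seq (bool * G)) : seq (G + bool) :=
  if l is (e, g) :: k then syl_word k ++ [:: inl g; inr e] else [::].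

Lemma nf_push_syl_word l : syl_reduced l ->
  foldl nf_push (1, [::]) (syl_word l) = (1, l).
Proof.
elim: l => //= -[e g] k IH [ne /IH E]; rewrite foldl_cat E /= mul1g.
case: k ne {IH E} => [|[e' g'] k] //= ne;
  case: ifP => // /andP[/eqP ee /asboolP d].
by case: ne.
Qed.

Local Notation K := (HNN A phi).

Definition hnn_pow (e : bool) : K :=
  if e then hnn_t A phi else (hnn_t A phi)^-1.

Fixpoint syl_val (l : seq (bool * G)) : K :=
  if l is (e, g) :: k then syl_val k * hnn_emb A phi g * hnn_pow e else 1.

Definition nf_val (s : G * seq (bool * G)) : K :=
  syl_val s.2 * hnn_emb A phi s.1.

Lemma hnn_class_cat u v : hnn_class A phi (u ++ v) = hnn_class A phi u *
  hnn_class A phi v.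
Proof. by rewrite [RHS]hnn_mulE. Qed.

Lemma hnn_class_pow e : hnn_class A phi [:: inr e] = hnn_pow e.
Proof. by case: e => //=; rewrite [RHS]hnn_invE. Qed.

Lemma syl_word_val l : hnn_class A phi (syl_word l) = syl_val l.
Proof.
elim: l => //= -[e g] k IH.
by rewrite hnn_class_cat IH -cat1s hnn_class_cat hnn_class_pow mulgA.
Qed.

Lemma hnn_emb1 : hnn_emb A phi 1 = 1.
Proof. by apply: (mulgI (hnn_emb A phi 1)); rewrite -hnn_embM !mulg1. Qed.

Lemma hnn_embV g : hnn_emb A phi g^-1 = (hnn_emb A phi g)^-1.
Proof. by apply: (mulgI (hnn_emb A phi g));
  rewrite -hnn_embM !mulgV hnn_emb1. Qed.

Lemma hnn_powJ e a : dom e a ->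
  hnn_pow e * hnn_emb A phi (f e a) = hnn_emb A phi a * hnn_pow e.
Proof.
case: e => da /=; rewrite /hnn_pow;
  first by rewrite -(hnn_tJ _ da) !mulgA mulgV mul1g.
have db : A (f false a) := f_dom (e := false) da.
have := hnn_tJ phi db; rewrite /phi (assoc_mapKV (e := true)) // => <-.
by rewrite mulgK.
Qed.

Lemma syl_eqv_val c l l' : syl_eqv c l l' ->
  syl_val l * hnn_emb A phi c = syl_val l'.
Proof.
elim: l c l' => [|[e g] k IH] c [|[e' g'] k'] //=.
  by move=> ->; rewrite hnn_emb1 mulg1.
case=> <- [a [da -> /IH <-]]; rewrite -mulgA hnn_powJ // !mulgA.
congr (_ * _); rewrite -!(mulgA (syl_val k)) -!hnn_embM.
by rewrite mulgVK.
Qed.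

Lemma nf_eqv_val s s' : nf_eqv s s' -> nf_val s = nf_val s'.
Proof.
by move=> /syl_eqv_val E; rewrite /nf_val -E -mulgA -hnn_embM mulgVK.
Qed.

Lemma nf_val_push s x : nf_val (nf_push s x) = nf_val s * hnn_class A phi [::
  x].
Proof.
case: s x => g l [h|e]; first by rewrite /nf_val /= hnn_embM mulgA.
rewrite hnn_class_pow /=; have cons : nf_val (1, (e, g) :: l) = nf_val (g,
  l) * hnn_pow e.
  by rewrite /nf_val /= hnn_emb1 mulg1.
case: l cons => // -[e' g'] k cons; case: ifP => // /andP[/eqP-> /asboolP dg].
rewrite /nf_val /= hnn_embM -!mulgA; congr (_ * (_ * _)).
rewrite -hnn_powJ // mulgA; case: (e);
  rewrite /hnn_pow /= ?mulVg ?mulgV mul1g //.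
Qed.

Lemma nf_val_push_seq u s : nf_val (foldl nf_push s u) = nf_val s * hnn_class
  A phi u.
Proof.
elim: u s => [|x u IH] s /=; first by rewrite [hnn_class _ _ _]/(1 : K) mulg1.
by rewrite IH nf_val_push -mulgA -(cat1s x u) hnn_class_cat.
Qed.

(** Pushing the word of a reduced state onto the trivial state meets no cancellation and returns
    that state. Equal values mean equivalent words, and these are pushed to equivalent states. This
    is Britton's lemma for two reduced words. *)
Theorem nf_val_inj s s' : syl_reduced s.2 -> syl_reduced s'.2 ->
  nf_val s = nf_val s' <-> nf_eqv s s'.
Proof.
move=> rs rs'; split; last exact: nf_eqv_val.
have red t : syl_reduced t.2 ->
    foldl nf_push (1, [::]) (syl_word t.2 ++ [:: inl t.1]) = t.
  by move=> rt; rewrite foldl_cat nf_push_syl_word //= mul1g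
    -surjective_pairing.
have cls t : nf_val t = hnn_class A phi (syl_word t.2 ++ [:: inl t.1]).
  by rewrite hnn_class_cat syl_word_val.
by rewrite !cls => /hnn_classP/nf_push_hnn_equiv-/(_ (1, [::]) I); rewrite !red.
Qed.

Lemma syl_positive_reduced l : all fst l -> syl_reduced l.
Proof.
elim: l => //= -[[] g] k IH //= pk; split; last exact: IH.
by case: k pk {IH} => // -[[] g'] k //= _ [].
Qed.

Lemma syl_eqv_positive c l l' : syl_eqv c l l' -> all fst l = all fst l'.
Proof.
by elim: l c l' => [|[e g] k IH] c [|[e' g'] k'] //= [<- [a [_ _ /IH->]]].
Qed.

End Britton.

(** * Automata over groups *)

Section Words.
Local Open Scope group_scope.
Variables (I : finType) (G : groupType) (X : I -> G).
Notation word := (seq (letter I)).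
Implicit Types (w : word) (ws : seq word).

Lemma word_val_cat u v : word_val X (u ++ v) = word_val X u * word_val X v.
Proof. exact: big_cat. Qed.

Lemma word_val_flatten ws : word_val X (flatten ws) = \prod_(w <- ws) word_val
  X w.
Proof.
by elim: ws => [|w ws IH] /=;
  rewrite ?word_val_cat ?IH ?big_cons // /word_val !big_nil.
Qed.

Definition word_inv w : word := rev [seq (a.1, ~~ a.2) | a <- w].

Lemma word_val_inv w : word_val X (word_inv w) = (word_val X w)^-1.
Proof.
rewrite /word_inv; elim: w => [|[i b] w IH];
  first by rewrite /word_val !big_nil invg1.
rewrite /= rev_cons -cats1 word_val_cat IH -(cat1s (i,
  b) w) word_val_cat invgM; congr (_ * _).
by rewrite /word_val !big_seq1 /letter_val /=; case: b; rewrite ?invgK.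
Qed.

Lemma computable_word_inv (T : countType) (f : T -> word) : computable f ->
  computable (fun x => word_inv (f x)).
Proof.
move=> cf; apply: computable_rev.
apply: (@computable_map _ _ _ (fun _ (a : letter I) => (a.1, ~~ a.2))) => //.
by computability; apply: computable_negb; computability.
Qed.

Lemma effective_word : effective word.
Proof.
case: (pickP (mem {: letter I})) => [a _|noI].
  exact/effective_seq/(effective_finType a).
exists (fun _ => [::]); first exact: computable_cst.
by case=> // a; have := noI a.
Qed.

Lemma submonoid_genP (S : set G) g :
  submonoid_gen S g <-> exists2 s : seq G, (forall x, x \in s ->
    S x) & g = \prod_(x <- s) x.
Proof.
split=> [|[s sS ->] M [[/set_mem M1 MM] SM]]; last first.
  elim: s sS => [|x s IH] sS; first by rewrite big_nil.
  rewrite big_cons; apply/set_mem/MM; apply: mem_set.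
    by apply/SM/sS; rewrite mem_head.
  by apply: IH => y ys; apply: sS; rewrite inE ys orbT.
move/(_ [set g | exists2 s : seq G, (forall x, x \in s ->
  S x) & g = \prod_(x <- s) x]); apply.
split; last by move=> x Sx; exists [:: x]; rewrite ?big_seq1 // => y;
  rewrite inE => /eqP->.
split; first by apply: mem_set; exists [::]; rewrite ?big_nil.
move=> x y /set_mem[s sS ->] /set_mem[t tS ->]; apply: mem_set; exists (s ++ t).
  by move=> z; rewrite mem_cat => /orP[/sS|/tS].
by rewrite big_cat.
Qed.

(** Presents a finitely generated subgroup as a finitely generated submonoid, which loops at a
    single state accept. *)
Lemma subgroup_genP (S : set G) : subgroup_gen S = submonoid_gen (S `|` [set
  x^-1 | x in S]).
Proof.
apply/seteqP; split=> g.
  apply; split; last first.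
    by move=> x Sx; apply/submonoid_genP; exists [:: x];
      rewrite ?big_seq1 // => y; rewrite inE => /eqP->; left.
  split; first by apply/mem_set/submonoid_genP; exists [::]; rewrite ?big_nil.
  move=> x y /set_mem/submonoid_genP[s sS ->] /set_mem/submonoid_genP[t tS ->].
  apply/mem_set/submonoid_genP; exists (s ++ rev [seq x^-1 | x <- t]).
    move=> z; rewrite mem_cat mem_rev =>
      /orP[/sS//|/mapP[u /tS[Su|[v Sv <-]] ->]].
      by right; exists u.
    by left; rewrite invgK.
  rewrite big_cat; congr (_ * _); elim: t {tS} => [|u t IH];
    first by rewrite !big_nil invg1.
  by rewrite big_cons invgM IH /= rev_cons -cats1 big_cat big_seq1.
move=> /submonoid_genP[s sS ->] M [sM SM]; elim: s sS => [|x s IH] sS.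
  by rewrite big_nil; exact: subgroup1.
rewrite big_cons; apply: subgroupM => //; last first.
  by apply: IH => y ys; apply: sS; rewrite inE ys orbT.
by have /sS[/SM//|[y /SM My <-]] := mem_head x s; exact: subgroupV.
Qed.

Hypothesis genX : generates X.

Lemma word_val_surj g : exists w, word_val X w = g.
Proof.
have : setT g by []; rewrite -genX subgroup_genP => /submonoid_genP[s sS ->].
elim: s sS => [|x s IH] sS; first by exists [::]; rewrite /word_val !big_nil.
have [|w ww] := IH; first by move=> y ys; apply: sS; rewrite inE ys orbT.
have [a xa] : exists a, letter_val X a = x.
  have /sS[[i _ <-]|[y [i _ <-] <-]] := mem_head x s; first by exists (i, true).
  by exists (i, false).
by exists (a :: w); rewrite -(cat1s a w) word_val_cat ww big_cons /word_val
  big_seq1 xa.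
Qed.

Lemma finite_set_words (S : set G) : finite_set S ->
  exists l : seq word, S = [set word_val X w | w in [set` l]].
Proof.
move=> /finite_seqP[s ->]; elim: s => [|x s [l E]].
  by exists [::]; apply/seteqP; split=> // x [].
have [w <-] := word_val_surj x; exists (w :: l); apply/seteqP; split=> y /=.
  rewrite inE => /orP[/eqP->|ys]; first by exists w => //=; rewrite mem_head.
  by have : [set` s] y by []; rewrite E => -[v /= vl <-]; exists v => //=;
    rewrite inE vl orbT.
move=> [v /=]; rewrite inE => /orP[/eqP->|vl] <-; first by rewrite mem_head.
rewrite inE; apply/orP; right; suff : [set` s] (word_val X v) by [].
by rewrite E; exists v.
Qed.

Lemma submonoid_gen_words (l : seq word) g :
  submonoid_gen [set word_val X w | w in [set` l]] g <->
  exists2 ws : seq word, {subset ws <= l} & g = word_val X (flatten ws).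
Proof.
split=> [/submonoid_genP[s sS ->]|[ws wsl ->]]; last first.
  apply/submonoid_genP; exists (map (word_val X) ws); last first.
    by rewrite word_val_flatten big_map.
  by move=> x /mapP[w /wsl wl ->]; exists w.
elim: s sS => [|x s IH] sS; first by exists [::]; rewrite // /word_val !big_nil.
have [|ws wsl E] := IH; first by move=> y ys; apply: sS; rewrite inE ys orbT.
have /sS[w /= wl wx] := mem_head x s; exists (w :: ws).
  by move=> v; rewrite inE => /orP[/eqP->|/wsl].
by rewrite big_cons E /= word_val_cat wx.
Qed.

Lemma fg_subgroup_words (H : set G) : fg_subgroup H ->
  exists l : seq word, H = submonoid_gen [set word_val X w | w in [set` l]].
Proof.
move=> [S finS ->]; rewrite subgroup_genP.
have [|l ->] := @finite_set_words (S `|` [set x^-1 | x in S]); last by exists l.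
by rewrite finite_setU; split=> //; exact: finite_image.
Qed.

End Words.

(** * Effective construction and inspection of automata *)

Lemma computable_fsa (T L : countType) (i : T -> seq nat) (t : T ->
  seq (nat * L * nat))
    (f : T -> seq nat) : computable i -> computable t -> computable f ->
  computable (fun x => FSA (i x) (t x) (f x)).
Proof.
move=> ci ct cf; have : computable (fun x => (i x, t x, f x)) by computability.
by case/computableP=> r rr rE; apply/computableP; exists r.
Qed.

Lemma computable_fsa_prod (T L : countType) (M : T -> fsa L) : computable M ->
  computable (fun x => fsa_to_prod (M x)).
Proof. by case/computableP=> r rr rE; apply/computableP; exists r. Qed.

Lemma computable_fsa_init (T L : countType) (M : T -> fsa L) : computable M ->
  computable (fun x => fsa_init (M x)).
Proof. by move=> /computable_fsa_prod/computable_fst/computable_fst. Qed.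

Lemma computable_fsa_trans (T L : countType) (M : T -> fsa L) : computable M ->
  computable (fun x => fsa_trans (M x)).
Proof. by move=> /computable_fsa_prod/computable_fst/computable_snd. Qed.

Lemma computable_fsa_final (T L : countType) (M : T -> fsa L) : computable M ->
  computable (fun x => fsa_final (M x)).
Proof. by move=> /computable_fsa_prod/computable_snd. Qed.

Lemma fsa_path_cat (L : eqType) (M : fsa L) p u v q :
  fsa_path M p (u ++ v) q <-> exists2 r, fsa_path M p u r & fsa_path M r v q.
Proof.
elim: u p => [|a u IH] p /=; first by split=> [|[r ->]]//; exists p.
split=> [[r tr /IH[s pr ps]]|[s [r tr pr] ps]]; first by exists s => //;
  exists r.
by exists r => //; apply/IH; exists s.
Qed.

Ltac computability_list_step :=
  match goal with
  | |- computable (fun x => map _ _) => apply: computable_map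
  | |- computable (fun x => filter _ _) => apply: computable_filter
  | |- computable (fun x => all _ _) => apply: computable_all
  | |- computable (fun x => _ ++ _) => apply: computable_cat
  | |- computable (fun x => flatten _) => apply: computable_flatten
  | |- computable (fun x => nth _ _ _) => apply: computable_nth
  | |- computable (fun x => word_inv _) => apply: computable_word_inv
  | |- computable (fun x => in_mem (@?f x) (mem (@?s x))) =>
    apply: (@computable_mem _ _ f s)
  | |- computable (fun x => ~~ _) => apply: computable_negb
  | |- computable (fun x => _ && _) => apply: computable_andb
  | |- computable (fun x => _ || _) => apply: computable_orb
  | |- computable (fun x => FSA _ _ _) => apply: computable_fsa
  | |- computable (fun x => fsa_init _) => apply: computable_fsa_init
  | |- computable (fun x => fsa_trans _) => apply: computable_fsa_trans
  | |- computable (fun x => fsa_final _) => apply: computable_fsa_final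
  | |- computable (pair ?c) => apply: (@computable_pair _ _ _ (fun=> c) id)
  | |- computable (cons ?c) => apply: (@computable_cons _ _ (fun=> c) id)
  | |- computable (@fsa_init _) => apply: (@computable_fsa_init _ _ id)
  | |- computable (@fsa_trans _) => apply: (@computable_fsa_trans _ _ id)
  | |- computable (@fsa_final _) => apply: (@computable_fsa_final _ _ id)
  | H : computable ?g |- computable (fun x => ?g (@?f x)) =>
      refine (@computable_comp _ _ _ f g _ H)
  | _ => computability_step
  end.
Ltac computability ::= repeat computability_list_step.

(** * Automata with words as labels; the empty word gives silent transitions *)

Section WordAutomata.
Local Open Scope group_scope.
Variables (I : finType) (G : groupType) (X : I -> G).
Notation word := (seq (letter I)).

Definition wfsa_val (M : fsa word) : set G :=
  [set word_val X (flatten ws) | ws in fsa_lang M].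

Definition wfsa_words (l : seq word) : fsa word :=
  FSA [:: 0%N] [seq (0%N, w, 0%N) | w <- l] [:: 0%N].

Definition wfsa_word (w : word) : fsa word :=
  FSA [:: 0%N] [:: (0%N, w, 1%N)] [:: 1%N].

Lemma wfsa_wordE w : wfsa_val (wfsa_word w) = [set word_val X w].
Proof.
apply/seteqP; split=> g /=.
  move=> [[|w1 [|w2 ws]] [p [q [/=]]]]; rewrite !inE => /eqP-> /eqP->.
  - by [].
  - by move=> [r]; rewrite inE => /eqP[-> ->] _ <-; rewrite cats0.
  - by move=> [r]; rewrite inE => /eqP[_ ->] [s]; rewrite inE => /eqP[].
move=> ->; exists [:: w]; last by rewrite /= cats0.
by exists 0%N, 1%N; rewrite !inE; split=> //=; exists 1%N; rewrite // inE.
Qed.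

Lemma wfsa_wordsE l :
  wfsa_val (wfsa_words l) = submonoid_gen [set word_val X w | w in [set` l]].
Proof.
apply/seteqP; split=> g.
  move=> [ws [p [q [/=]]]]; rewrite !inE => /eqP-> /eqP-> path_ws <-.
  apply/submonoid_gen_words; exists ws => //.
  elim: ws path_ws => //= w ws IH [r /mapP[v vl [-> ->]] /IH wsl] u.
  by rewrite inE => /orP[/eqP->|/wsl].
move/submonoid_gen_words=> [ws wsl ->]; exists ws => //.
exists 0%N, 0%N; rewrite !inE; split=> //.
elim: ws wsl => //= w ws IH wsl; exists 0%N.
  by apply: map_f; apply: wsl; rewrite mem_head.
by apply: IH => v vws; apply: wsl; rewrite inE vws orbT.
Qed.

(** A disjoint union: the states of [M] become even, those of [N] odd, and [tr] adds links. *)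
Definition wfsa_join (ini : seq nat) (M N : fsa word) (tr : seq (nat * word *
  nat))
    (fin : seq nat) : fsa word :=
  FSA ini ([seq (t.1.1.*2, t.1.2, t.2.*2) | t <- fsa_trans M] ++
           [seq (t.1.1.*2.+1, t.1.2, t.2.*2.+1) | t <- fsa_trans N] ++ tr) fin.

Lemma doubleS_inj (m n : nat) : m.*2.+1 = n.*2.+1 -> m = n.
Proof. by case=> /double_inj. Qed.

Lemma double_neq (m n : nat) : m.*2 <> n.*2.+1.
Proof. by move/(congr1 odd); rewrite /= !odd_double. Qed.

Section Join.
Variables (ini fin : seq nat) (M N : fsa word) (L : seq (nat * nat)).
Let tr := [seq (l.1.*2, [::] : word, l.2.*2.+1) | l <- L].
Let J := wfsa_join ini M N tr fin.

Lemma wfsa_join_transP p w q : ((p, w, q) \in fsa_trans J) <->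
  [\/ exists p' q', [/\ (p', w, q') \in fsa_trans M, p = p'.*2 & q = q'.*2],
      exists p' q', [/\ (p', w, q') \in fsa_trans N,
        p = p'.*2.+1 & q = q'.*2.+1] |
      exists p' q', [/\ (p', q') \in L, p = p'.*2, w = [::] & q = q'.*2.+1]].
Proof.
rewrite !mem_cat; split=> [/or3P[]|[]].
- by move=> /mapP[[[p' w'] q'] t [-> -> ->]]; constructor 1; exists p', q'.
- by move=> /mapP[[[p' w'] q'] t [-> -> ->]]; constructor 2; exists p', q'.
- by move=> /mapP[[p' q'] t [-> -> ->]]; constructor 3; exists p', q'.
- by move=> [p' [q' [t -> ->]]]; apply/or3P; constructor 1; apply/mapP;
  exists (p', w, q').
- by move=> [p' [q' [t -> ->]]]; apply/or3P; constructor 2; apply/mapP;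
  exists (p', w, q').
- by move=> [p' [q' [t -> -> ->]]]; apply/or3P; constructor 3; apply/mapP;
  exists (p', q').
Qed.

Lemma wfsa_join_right p ws s :
  fsa_path J p.*2.+1 ws s <-> exists2 q, s = q.*2.+1 & fsa_path N p ws q.
Proof.
elim: ws p s => [|w ws IH] p s /=.
  by split=> [<-|[q -> ->]//]; exists p.
split=> [[r /wfsa_join_transP[]]|[q -> [r t pr]]].
- by move=> [p' [q' [_ /esym/double_neq]]].
- by move=> [p' [q' [t /doubleS_inj-> ->]]] /IH[q -> pq]; exists q => //;
  exists q'.
- by move=> [p' [q' [_ /esym/double_neq]]].
- exists r.*2.+1; first by apply/wfsa_join_transP; constructor 2; exists p, r.
  by apply/IH; exists q.
Qed.

(** Links lead from even to odd states only, so a path crosses from [M] to [N] at most once. *)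
Lemma wfsa_join_left p ws s : fsa_path J p.*2 ws s <->
  (exists2 q, s = q.*2 & fsa_path M p ws q) \/
  (exists u v l q, [/\ ws = u ++ [::] :: v, l \in L, fsa_path M p u l.1,
     fsa_path N l.2 v q & s = q.*2.+1]).
Proof.
elim: ws p s => [|w ws IH] p s /=.
  split=> [<-|[[q -> ->]//|[u [v [l [q []]]]]]]; first by left; exists p.
  by case: u.
split=> [[r /wfsa_join_transP[]]|[[q -> [r t pr]]|]].
- move=> [p' [q' [t /double_inj-> ->]]] /IH[[q ->
  pq]|[u [v [l [q [-> Ll pu pv ->]]]]]].
    by left; exists q => //; exists q'.
  by right; exists (w :: u), v, l, q; split=> //; exists q'.
- by move=> [p' [q' [_ /double_neq]]].
- move=> [p' [q' [t /double_inj-> -> ->]]] /wfsa_join_right[q -> pq].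
  by right; exists [::], ws, (p', q'), q.
- exists r.*2; first by apply/wfsa_join_transP; constructor 1; exists p, r.
  by apply/IH; left; exists q.
- move=> [[|w' u] [v [l [q [[ew ews] Ll /= pu pv es]]]]]; subst w ws s.
    exists l.2.*2.+1; last by apply/wfsa_join_right; exists q.
    by apply/wfsa_join_transP; constructor 3; exists l.1, l.2;
      rewrite -surjective_pairing pu.
  move: pu => [r t pu]; exists r.*2; first by apply/wfsa_join_transP;
    constructor 1; exists p, r.
  by apply/IH; right; exists u, v, l, q.
Qed.
End Join.

Definition wfsa_add (MN : fsa word * fsa word) :=
  wfsa_join ([seq p.*2 | p <- fsa_init MN.1] ++ [seq p.*2.+1 | p <- fsa_init
    MN.2])
    MN.1 MN.2 [::]
    ([seq p.*2 | p <- fsa_final MN.1] ++ [seq p.*2.+1 | p <- fsa_final MN.2]).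

Definition wfsa_mul (MN : fsa word * fsa word) :=
  wfsa_join [seq p.*2 | p <- fsa_init MN.1] MN.1 MN.2
    [seq (l.1.*2, [::], l.2.*2.+1) |
       l <- flatten [seq [seq (p,
         q) | q <- fsa_init MN.2] | p <- fsa_final MN.1]]
    [seq p.*2.+1 | p <- fsa_final MN.2].

Lemma wfsa_addE M N : wfsa_val (wfsa_add (M, N)) = wfsa_val M `|` wfsa_val N.
Proof.
apply/seteqP; split=> g.
  move=> [ws [p [q [/=]]]]; rewrite !mem_cat => /orP[]/mapP[p' ip ->] fq.
    move/(wfsa_join_left _ _ _ _ [::]) => [[q' E pq]|[u [v [l [? []]]]]//] <-.
    left; exists ws => //; exists p', q'; split=> //; move: fq; rewrite E.
    by case/orP=> /mapP[r fr]; [move/double_inj=> ->|move/double_neq].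
  move/(wfsa_join_right _ _ _ _ [::]) => [q' E pq] <-.
  right; exists ws => //; exists p', q'; split=> //; move: fq; rewrite E.
  by case/orP=> /mapP[r fr]; [move/esym/double_neq|move/doubleS_inj=> ->].
case=> -[ws [p [q [ip fq pq]]] <-]; exists ws => //.
  exists p.*2, q.*2; rewrite !mem_cat !map_f //; split=> //.
  by apply/(wfsa_join_left _ _ _ _ [::]); left; exists q.
exists p.*2.+1, q.*2.+1; rewrite !mem_cat !(map_f (fun p =>
  p.*2.+1)) ?orbT //; split=> //.
by apply/(wfsa_join_right _ _ _ _ [::]); exists q.
Qed.

Lemma wfsa_mulE M N :
  wfsa_val (wfsa_mul (M, N)) = [set x * y | x in wfsa_val M & y in wfsa_val N].
Proof.
apply/seteqP; split=> g.
  move=> [ws [p [q [/= /mapP[p' ip ->] /mapP[q' fq ->]]]]].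
  move/wfsa_join_left => [[r /esym/double_neq]//|[u [v [l [r [-> Ll pu
    pv]]]]]] /doubleS_inj E <-.
  move: Ll => /flattenP[_ /mapP[f ff ->] /mapP[i ii El]];
    rewrite El -?E /= in pu pv.
  exists (word_val X (flatten u)); first by exists u => //; exists p', f.
  exists (word_val X (flatten v)); first by exists v => //; exists i, q'.
  by rewrite flatten_cat word_val_cat.
move=> [_ [u [p [f [ip ff pu]] <-]] [_ [v [i [q [ii fq pv]] <-]] <-]].
exists (u ++ [::] :: v); last by rewrite flatten_cat word_val_cat.
exists p.*2, q.*2.+1; split; [exact: map_f | exact: map_f |].
apply/wfsa_join_left; right; exists u, v, (f, i), q; split=> //.
by apply/flattenP; exists [seq (f, q) | q <- fsa_init N]; apply: map_f.
Qed.

Lemma computable_wfsa_word : computable wfsa_word.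
Proof. by rewrite /wfsa_word; computability. Qed.

Lemma computable_wfsa_add : computable wfsa_add.
Proof. by rewrite /wfsa_add /wfsa_join; computability. Qed.

Lemma computable_wfsa_mul : computable wfsa_mul.
Proof. by rewrite /wfsa_mul /wfsa_join; computability. Qed.
End WordAutomata.

(** * From word labels to letters *)

Section Unfold.
Local Open Scope group_scope.
Variables (I : finType) (G : groupType) (X : I -> G) (x : I).
Notation word := (seq (letter I)).

(* The state [(u, q)] means that [u] remains to be read before entering [q]. *)
Definition pending (u : word) (q : nat) : nat := pickle (u, q).

Lemma pending_inj u q u' q' : pending u q = pending u' q' -> u = u' /\ q = q'.
Proof. by move/(pcan_inj pickleK)=> -[-> ->]. Qed.

Fixpoint pending_trans (u : word) (q : nat) : seq (nat * letter I * nat) :=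
  if u is a :: u' then (pending u q, a,
    pending u' q) :: pending_trans u' q else [::].

Lemma pending_transP u q s a r : (s, a, r) \in pending_trans u q ->
  exists u', s = pending (a :: u') q /\ r = pending u' q.
Proof.
elim: u => //= b u IH; rewrite inE => /orP[/eqP[-> -> ->]|/IH//]; by exists u.
Qed.

(* The prefix [x x^-1] makes every label nonempty. *)
Definition unfold_trans (t : nat * word * nat) : seq (nat * letter I * nat) :=
  (pending [::] t.1.1, (x, true), pending ((x, false) :: t.1.2) t.2) ::
  pending_trans ((x, false) :: t.1.2) t.2.

Definition unfold_fsa (M : fsa word) : fsa (letter I) :=
  FSA [seq pending [::] p | p <- fsa_init M]
    (flatten [seq unfold_trans t | t <- fsa_trans M])
    [seq pending [::] p | p <- fsa_final M].

Definition pad (w : word) : word := [:: (x, true), (x, false) & w].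

Lemma word_val_pad w : word_val X (pad w) = word_val X w.
Proof. by rewrite /word_val !big_cons /letter_val /= mulgA mulgV mul1g. Qed.

Lemma word_val_flatten_pad ws : word_val X (flatten (map pad ws)) = word_val X
  (flatten ws).
Proof.
rewrite !word_val_flatten big_map; apply: eq_bigr => w _; exact: word_val_pad.
Qed.

Lemma fsa_path_pending M (u v : word) q : {subset pending_trans (u ++ v) q <=
  fsa_trans M} ->
  fsa_path M (pending (u ++ v) q) u (pending v q).
Proof.
elim: u => //= a u IH sub; exists (pending (u ++ v) q); first by apply: sub;
  rewrite mem_head.
by apply: IH => t tu; apply: sub; rewrite inE tu orbT.
Qed.

Lemma unfold_path M p ws q : fsa_path M p ws q ->
  fsa_path (unfold_fsa M) (pending [::] p) (flatten (map pad ws)) (pending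
    [::] q).
Proof.
elim: ws p => [|w ws IH] p; first by move=> ->.
move=> [r t pr]; have sub : {subset unfold_trans (p, w,
  r) <= fsa_trans (unfold_fsa M)}.
  move=> y yt; apply/flattenP; exists (unfold_trans (p, w, r)) => //.
  exact: map_f.
apply/(fsa_path_cat (unfold_fsa M) _ (pad w)).
exists (pending [::] r); last exact: IH.
exists (pending ((x, false) :: w) r); first by apply: sub; rewrite mem_head.
rewrite -{1}[_ :: w]cats0; apply: fsa_path_pending; rewrite cats0 => y yt.
by apply: sub; rewrite inE yt orbT.
Qed.

(** Generalised over the pending word [u] for the induction. A state with a pending letter admits
    that letter only, and a new transition of [M] can start only when nothing is pending. *)
Lemma unfold_path_inv M u p z q :
  fsa_path (unfold_fsa M) (pending u p) z (pending [::] q) ->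
  exists2 ws, z = u ++ flatten (map pad ws) & fsa_path M p ws q.
Proof.
elim: z u p => [|a z IH] u p.
  by move=> /pending_inj[-> ->]; exists [::].
move=> [r /flattenP[_ /mapP[[[p1 w] q1] t ->]]].
rewrite inE => /orP[/eqP[/pending_inj[-> ->] ->
  ->]|/pending_transP[u' [/pending_inj[-> ->] ->]]].
  by move=> /IH[ws -> pws]; exists (w :: ws) => //=; exists q1.
by move=> /IH[ws -> pws]; exists ws.
Qed.

Lemma unfold_fsaE M : fsa_val X (unfold_fsa M) = wfsa_val X M.
Proof.
apply/seteqP; split=> g.
  move=> [z [_ [_ [/mapP[p ip ->] /mapP[q fq ->] /unfold_path_inv[ws ->
    pws]]]] <-].
  by rewrite word_val_flatten_pad; exists ws => //; exists p, q.
move=> [ws [p [q [ip fq /unfold_path pws]]] <-].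
exists (flatten (map pad ws)); last exact: word_val_flatten_pad.
by exists (pending [::] p), (pending [::] q); split=> //; apply: map_f.
Qed.

Lemma computable_pending_trans (T : countType) (u : T -> word) (q : T -> nat) :
  computable u -> computable q ->
    computable (fun y => pending_trans (u y) (q y)).
Proof.
move=> cu cq.
(* A transition mentions the remaining suffix, which a fold does not see, so it is rebuilt as a
   second component. *)
pose g (y : T) a (r : seq (nat * letter I * nat) * word) :=
  ((pending (a :: r.2) (q y), a, pending r.2 (q y)) :: r.1, a :: r.2).
apply: (@computable_ext _ _ (fun y =>
  (foldr (g y) ([::], [::]) (u y)).1)) => [y|].
  suff -> : foldr (g y) ([::], [::]) (u y) = (pending_trans (u y) (q y),
    u y) by [].
  by elim: (u y) => //= a v ->.
apply: computable_fst; apply: computable_foldr => //; first by computability.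
by rewrite /g /pending; computability.
Qed.

Lemma computable_unfold : computable unfold_fsa.
Proof.
rewrite /unfold_fsa /unfold_trans; computability; rewrite /pending;
  computability.
by apply: computable_pending_trans; computability.
Qed.
End Unfold.

(** * Subgroup membership, the word problem and homomorphisms on words *)

Section Decidability.
Local Open Scope group_scope.
Variables (n : nat) (G : groupType) (X : 'I_n -> G).
Notation word := (seq (letter 'I_n)).
Hypothesis genX : generates X.
Hypothesis ratG : decidable_rational_membership X.

Lemma decidable_wfsa : (0 < n)%N -> decidable_pred (fun p : fsa word * word =>
  wfsa_val X p.1 (word_val X p.2)).
Proof.
case: n X ratG => // m Y [d cd dP] _.
exists (fun p => d (unfold_fsa ord0 p.1, p.2)).
  by have cu := computable_unfold (@ord0 m); computability.
by move=> [M w] /=; rewrite dP /= unfold_fsaE.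
Qed.

Lemma trivial_group (g : G) : n = 0%N -> g = 1.
Proof.
move=> n0; have [[|[[i lt_in] b] w] <-] := word_val_surj genX g.
  by rewrite /word_val big_nil.
by have := ltn_ord (Ordinal lt_in); rewrite [X in _ < X]n0.
Qed.

Lemma decidable_fg_subgroup (H : set G) : is_subgroup H -> fg_subgroup H ->
  decidable_membership X H.
Proof.
move=> sH /(fg_subgroup_words genX)[l HE]; have [n0|n_gt0] := posnP n.
  exists (fun _ => true) => [|w]; first exact: computable_cst.
  by split=> // _; rewrite [word_val _ _]trivial_group //; exact: subgroup1.
have [d cd dP] := decidable_wfsa n_gt0; exists (fun w => d (wfsa_words l, w)).
  by computability.
by move=> w; rewrite dP /= wfsa_wordsE HE.
Qed.

(** The word problem is membership in a singleton, which is rational. *)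
Lemma decidable_word_eq : decidable_pred (fun p : word * word =>
  word_val X p.1 = word_val X p.2).
Proof.
have [n0|n_gt0] := posnP n.
  exists (fun _ => true) => [|w]; first exact: computable_cst.
  by split=> // _; rewrite [LHS]trivial_group // [RHS]trivial_group.
have [d cd dP] := decidable_wfsa n_gt0.
exists (fun p => d (wfsa_word p.2, p.1)).
  by have cw := computable_wfsa_word 'I_n; computability.
by move=> p; rewrite dP /= wfsa_wordE.
Qed.

(** The algorithm searches for an expression of the given word in generators of [H] and substitutes
    words for their images. The function [fl] comes from choice, but only its finitely many values
    in the constant [L] enter. *)
Lemma computable_hom_words (H : set G) (f : G -> G) :
  is_subgroup H -> fg_subgroup H -> {in H &, {morph f : x y / x * y}} ->
  exists2 fw : word -> word, computable fw &
    forall w, H (word_val X w) -> word_val X (fw w) = f (word_val X w).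
Proof.
move=> sH fgH fM; have [dH cdH dHP] := decidable_fg_subgroup sH fgH.
have [de cde deP] := decidable_word_eq.
have [l HE] := fg_subgroup_words genX fgH.
have /(_ _)/cid-/all_sig[fl flE] w := word_val_surj genX (f (word_val X w)).
pose L := [seq (w, fl w) | w <- l].
pose lhs m := flatten [seq (nth ([::], [::]) L i).1 | i <- CodeSeq.decode m].
pose rhs m := flatten [seq (nth ([::], [::]) L i).2 | i <- CodeSeq.decode m].
(* The first alternative stops the search on words with value outside [H], where no expression
   exists. *)
pose P (p : word * nat) := ~~ dH p.1 || de (p.1, lhs p.2).
have exP w : exists m, P (w, m).
  rewrite /P /=; case: (boolP (dH w)) => [/dHP|_]; last by exists 0%N.
  rewrite HE => /submonoid_gen_words[ws wsl E];
    exists (CodeSeq.code [seq index v l | v <- ws]).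
  apply/deP; rewrite /lhs CodeSeq.codeK /= E -map_comp;
    congr (word_val _ (flatten _)).
  rewrite -[LHS]map_id; apply/eq_in_map => v /wsl vl /=.
  by rewrite (nth_map [::]) ?index_mem // nth_index.
have cdec := computable_decode.
have cl : computable lhs by rewrite /lhs; computability.
have cr : computable rhs by rewrite /rhs; computability.
exists (fun w => rhs (ex_minn (exP w))).
  apply: computable_comp cr; apply: computable_search;
    first exact: effective_word.
  by rewrite /P; computability.
move=> w Hw; case: ex_minnP => m Pm _; move: Pm; rewrite /P /=.
have -> /= : dH w by exact/dHP.
move/deP => /= ->; rewrite /lhs /rhs.
have f1 : f 1 = 1.
  apply: (mulgI (f 1)); by rewrite -fM ?mulg1 //; apply: mem_set;
    exact: subgroup1.
have Hv v : v \in l -> H (word_val X v).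
  by move=> vl; rewrite HE; apply/submonoid_gen_words; exists [:: v];
    rewrite /= ?cats0 // => u; rewrite inE => /eqP->.
(* An index out of range gives the default pair of empty words, which is correct since [f 1 = 1];
   hence every number found encodes a valid substitution. *)
have one i : H (word_val X (nth ([::], [::]) L i).1) /\
    word_val X (nth ([::], [::]) L i).2 = f (word_val X (nth ([::],
      [::]) L i).1).
  have [lt_il|ge] := ltnP i (size l).
    by rewrite (nth_map [::]) //= flE; split=> //; apply/Hv/mem_nth.
  rewrite nth_default ?size_map //= /word_val big_nil f1; split=> //.
  exact: subgroup1.
suff : H (word_val X (flatten [seq (nth ([::],
  [::]) L i).1 | i <- CodeSeq.decode m])) /\
  word_val X (flatten [seq (nth ([::], [::]) L i).2 | i <- CodeSeq.decode m]) =
  f (word_val X (flatten [seq (nth ([::],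
    [::]) L i).1 | i <- CodeSeq.decode m])) by case.
elim: (CodeSeq.decode m) => [|i s [IH1 IH2]] /=.
  by rewrite /word_val big_nil f1; split=> //; exact: subgroup1.
have [H1 H2] := one i; rewrite !word_val_cat H2 IH2 fM; try exact: mem_set.
by split=> //; exact: subgroupM.
Qed.
End Decidability.

(** * Images of rational subsets of an associated subgroup *)

Section Relabel.
Local Open Scope group_scope.
Variables (n : nat) (G : groupType) (X : 'I_n -> G).
Notation word := (seq (letter 'I_n)).
Variables (A : set G) (f : G -> G) (dA : word -> bool) (fw : word -> word).
Hypothesis subA : is_subgroup A.
Hypothesis fM : {in A &, {morph f : x y / x * y}}.
Hypothesis dAP : forall w, dA w <-> A (word_val X w).
Hypothesis fwP : forall w, A (word_val X w) ->
  word_val X (fw w) = f (word_val X w).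

(* A certificate [(P, D, u)] consists of lists [P] and [D] containing all
   reachable states and only dead states respectively, and of words [u_q] such
   that [u_p a u_q^-1] lies in [A] for every useful transition [(p, a, q)]. *)
Notation certificate := (seq nat * seq nat * seq word)%type.
Implicit Types (N : fsa (letter 'I_n)) (c : certificate).

Definition potential c q : word := nth [::] c.2 q.

Definition transition_word c (t : nat * letter 'I_n * nat) : word :=
  potential c t.1.1 ++ t.1.2 :: word_inv (potential c t.2).

(** Closure under transitions, with the clauses for initial and final states, forces [P] to contain
    the reachable states and [D] to consist of dead ones. Useful initial and final states carry the
    empty word, so that the products telescoped along accepting paths have no boundary terms. All
    clauses are finite checks once [dA] decides [A]. *)
Definition certified (Nc : fsa (letter 'I_n) * certificate) : bool :=
  [&& all (fun i => (i \in Nc.2.1.1) && ((i \in Nc.2.1.2) || (potential Nc.2 i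
    == [::])))
        (fsa_init Nc.1),
      all (fun q => (q \notin Nc.2.1.2) && ((q \notin Nc.2.1.1) || (potential
        Nc.2 q == [::])))
        (fsa_final Nc.1) &
      all (fun t => [&& (t.1.1 \notin Nc.2.1.1) || (t.2 \in Nc.2.1.1),
                        (t.1.1 \notin Nc.2.1.2) || (t.2 \in Nc.2.1.2) &
                        [|| t.1.1 \notin Nc.2.1.1, t.2 \in Nc.2.1.2 |
                            dA (transition_word Nc.2 t)]]) (fsa_trans Nc.1)].

Definition relabel (Nc : fsa (letter 'I_n) * certificate) : fsa word :=
  FSA [seq i <- fsa_init Nc.1 | i \notin Nc.2.1.2]
      [seq (t.1.1, fw (transition_word Nc.2 t), t.2) |
         t <- [seq t <- fsa_trans Nc.1 | (t.1.1 \in Nc.2.1.1) && (t.2 \notin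
           Nc.2.1.2)]]
      (fsa_final Nc.1).

Lemma computable_certified : computable dA -> computable certified.
Proof. by move=> cd; rewrite /certified /transition_word /potential;
  computability. Qed.

Lemma computable_relabel : computable fw -> computable relabel.
Proof. by move=> cf; rewrite /relabel /transition_word /potential;
  computability. Qed.

Let f1 : f 1 = 1.
Proof.
by apply: (mulgI (f 1)); rewrite -fM ?mulg1 //; apply: mem_set;
  exact: subgroup1.
Qed.

Section Correct.
Variables (N : fsa (letter 'I_n)) (c : certificate).
Hypothesis okc : certified (N, c).

Let u q := word_val X (potential c q).

Lemma certified_init i : i \in fsa_init N ->
  i \in c.1.1 /\ (i \notin c.1.2 -> u i = 1).
Proof.
move=> ii; case/and3P: okc => /allP/(_ _ ii)/andP[-> H] _ _; split=> // nd.
by move: H; rewrite (negbTE nd) /u => /eqP->; rewrite /word_val big_nil.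
Qed.

Lemma certified_final q : q \in fsa_final N ->
  q \notin c.1.2 /\ (q \in c.1.1 -> u q = 1).
Proof.
move=> fq; case/and3P: okc => _ /allP/(_ _ fq)/andP[-> H] _; split=> // Pq.
by move: H; rewrite Pq /u => /eqP->; rewrite /word_val big_nil.
Qed.

Lemma certified_trans p a q : (p, a, q) \in fsa_trans N ->
  [/\ p \in c.1.1 -> q \in c.1.1, q \notin c.1.2 -> p \notin c.1.2 &
      p \in c.1.1 -> q \notin c.1.2 ->
      A (u p * letter_val X a * (u q)^-1) /\
      word_val X (fw (transition_word c (p, a,
        q))) = f (u p * letter_val X a * (u q)^-1)].
Proof.
move=> t; case/and3P: okc => _ _ /allP/(_ _ t)/and3P[/= H1 H2 H3]; split.
- by move=> Pp; move: H1; rewrite Pp.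
- by move=> Dq; move: H2; rewrite (negbTE Dq) orbF.
move=> Pp Dq; move: H3; rewrite Pp (negbTE Dq) /= => /dAP HA.
have E : word_val X (transition_word c (p, a,
  q)) = u p * letter_val X a * (u q)^-1.
  rewrite /transition_word word_val_cat -cat1s word_val_cat word_val_inv /=
    mulgA.
  by rewrite {2}/word_val big_seq1.
by rewrite fwP //; rewrite E in HA *.
Qed.

Lemma relabel_path p z q : fsa_path N p z q -> p \in c.1.1 -> q \notin c.1.2 ->
  [/\ q \in c.1.1, p \notin c.1.2, A (u p * word_val X z * (u q)^-1) &
   exists2 ws, fsa_path (relabel (N, c)) p ws q &
     word_val X (flatten ws) = f (u p * word_val X z * (u q)^-1)].
Proof.
elim: z p => [|a z IH] p.
  move=> /= -> Pq Dq; rewrite /word_val big_nil mulg1 mulgV; split=> //.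
    exact: subgroup1.
  by exists [::]; rewrite ?f1 // /word_val big_nil.
move=> [r t pz] Pp Dq; have [Pr Dr HA] := certified_trans t.
have [Pq nDr Az [ws pws vws]] := IH _ pz (Pr Pp) Dq.
have [At ft] := HA Pp nDr.
have E : u p * word_val X (a :: z) * (u q)^-1 =
    (u p * letter_val X a * (u r)^-1) * (u r * word_val X z * (u q)^-1).
  rewrite -cat1s word_val_cat !mulgA mulgVK; congr (_ * _ * _ * _).
  by rewrite /word_val big_seq1.
split=> //; first exact: Dr.
  by rewrite E; apply: subgroupM.
exists (fw (transition_word c (p, a, r)) :: ws).
  exists r => //; apply/mapP; exists (p, a, r) => //.
  by rewrite mem_filter /= Pp nDr.
by rewrite /= word_val_cat ft vws E -fM //; exact: mem_set.
Qed.

Lemma relabel_path_inv p ws q : fsa_path (relabel (N, c)) p ws q ->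
  p \notin c.1.2 ->
  q \notin c.1.2 /\ exists2 z, fsa_path N p z q & p \in c.1.1 ->
   word_val X (flatten ws) = f (u p * word_val X z * (u q)^-1).
Proof.
elim: ws p => [|w ws IH] p.
  move=> /= -> Dq; split=> //; exists [::] => // Pq.
  by rewrite /word_val !big_nil mulg1 mulgV f1.
move=> [r /mapP[[[p' a] r'] + [-> -> ->]] pws];
  rewrite mem_filter /= => /andP[/andP[Pp nDr] t] nDp.
have [Dq [z pz vz]] := IH _ pws nDr; split=> //; exists (a :: z);
  first by exists r'.
move=> _; have [Pr _ /(_ Pp nDr)[_ ft]] := certified_trans t.
(* Both factors have to be placed in [A] before [f] may be taken as multiplicative on them. *)
have [_ _ Az _] := relabel_path pz (Pr Pp) Dq.
have [_ _ /(_ Pp nDr)[Aa _]] := certified_trans t.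
rewrite word_val_cat ft vz ?Pr // -fM; try exact: mem_set.
congr f; rewrite -cat1s word_val_cat !mulgA mulgVK; congr (_ * _ * _ * _).
by rewrite /word_val big_seq1.
Qed.

Lemma relabelE : wfsa_val X (relabel (N, c)) = [set f x | x in fsa_val X N].
Proof.
apply/seteqP; split=> g.
  move=> [ws [p [q [/=]]]]; rewrite mem_filter => /andP[nDp ip] fq pws <-.
  have [Pp /(_ nDp) up1] := certified_init ip.
  have [nDq uq1] := certified_final fq.
  have [_ [z pz vz]] := relabel_path_inv pws nDp.
  have [Pq _ _ _] := relabel_path pz Pp nDq.
  exists (word_val X z); first by exists z => //; exists p, q.
  by rewrite vz // up1 uq1 // mul1g invg1 mulg1.
move=> [_ [z [p [q [ip fq pz]]] <-] <-].
have [Pp up1] := certified_init ip; have [nDq uq1] := certified_final fq.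
have [Pq nDp _ [ws pws vws]] := relabel_path pz Pp nDq.
exists ws; last by rewrite vws up1 // uq1 // mul1g invg1 mulg1.
by exists p, q; split=> //=; rewrite mem_filter nDp.
Qed.
End Correct.

Definition fsa_states N : seq nat :=
  fsa_init N ++ fsa_final N ++ flatten [seq [:: t.1.1; t.2] | t <- fsa_trans N].

(** If [w] and [v] both lead to [q] and [s] leads from [q] to a final state, then [w s] and [v s]
    have values in [A], hence so does [w v^-1]. So any [v] reaching [q] may serve as [u_q]. The
    empty word serves at initial states, where [s] alone is accepted, and at final states, where [w]
    alone is. *)
Lemma certificate_exists N : (forall g, fsa_val X N g -> A g) ->
  exists c, certified (N, c).
Proof.
(* Any strict upper bound for the states would do; it turns [P], [D] and the words into finite
   lists. *)
move=> NA; pose b := (sumn (fsa_states N)).+1.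
have lt_b q : q \in fsa_states N -> (q < b)%N.
  rewrite ltnS; elim: (fsa_states N) => //= y s IH; rewrite inE.
  by move=> /orP[/eqP->|/IH le]; rewrite ?leq_addr // (leq_trans le) ?leq_addl.
pose reach q w := exists2 i, i \in fsa_init N & fsa_path N i w q.
pose coreach q w := exists2 k, k \in fsa_final N & fsa_path N q w k.
pose P := [seq q <- iota 0 b | `[< exists w, reach q w >]].
pose D := [seq q <- iota 0 b | ~~ `[< exists w, coreach q w >]].
pose v q : word := if (q \in fsa_init N) || (q \in fsa_final N) then [::]
  else xget [::] [set w | reach q w].
have nth_v q : q \in fsa_states N -> nth [::] (mkseq v b) q = v q.
  by move=> /lt_b; exact: nth_mkseq.
have PE q : q \in fsa_states N -> (q \in P) = `[< exists w, reach q w >].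
  by move=> /lt_b qb; rewrite mem_filter mem_iota add0n qb /= andbT.
have DE q : q \in fsa_states N -> (q \in D) = ~~ `[< exists w, coreach q w >].
  by move=> /lt_b qb; rewrite mem_filter mem_iota add0n qb /= andbT.
have stI q : q \in fsa_init N -> q \in fsa_states N by move=> H;
  rewrite !mem_cat H.
have stF q : q \in fsa_final N -> q \in fsa_states N by move=> H;
  rewrite !mem_cat H orbT.
have stT t : t \in fsa_trans N ->
  t.1.1 \in fsa_states N /\ t.2 \in fsa_states N.
  move=> tt; split; rewrite !mem_cat; apply/or3P; constructor 3; apply/flattenP;
    exists [:: t.1.1; t.2]; rewrite ?inE ?eqxx ?orbT //; exact: map_f.
have reachA q w s : reach q w -> coreach q s -> A (word_val X w * word_val X s).
  move=> [i ii pw] [k fk ps]; rewrite -word_val_cat; apply: NA;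
    exists (w ++ s) => //.
  by exists i, k; split=> //; apply/fsa_path_cat; exists q.
have trim q w s : reach q w -> coreach q s ->
  A (word_val X w * (word_val X (v q))^-1).
  move=> rw cs; rewrite /v; case: ifP => [/orP[iq|fq]|_].
  - have As : A (word_val X s).
      by have := reachA q [::] s; rewrite {1}/word_val big_nil mul1g;
        apply=> //; exists q.
    rewrite /word_val big_nil invg1 mulg1; apply/(subgroupMr _ subA As).
    exact: reachA rw cs.
  - have := reachA q w [::] rw; rewrite /word_val big_nil invg1; apply;
    by exists q.
  - have rv : reach q (xget [::] [set w | reach q w]) by exact: (@xgetI _ _ _
    w).
    (* Here [w v^-1] is written as [(w s) (v s)^-1]. *)
    rewrite -(mulgKA (word_val X s)).
    by apply: subgroupF => //; exact: reachA cs.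
exists (P, D, mkseq v b); apply/and3P; split; apply/allP => /=.
- move=> i ii; rewrite PE ?DE /potential ?nth_v ?stI //= /v ii /= orbT andbT.
  by apply/asboolP; exists [::]; exists i.
- move=> k fk; rewrite PE ?DE /potential ?nth_v ?stF //= /v fk orbT /= orbT
  andbT negbK.
  by apply/asboolP; exists [::]; exists k.
move=> [[p a] q] t; have [/= sp sq] := stT _ t.
rewrite !PE ?DE // !negbK; apply/and3P; split.
- case: asboolP => //= -[w [i ii pw]]; apply/asboolP; exists (w ++ [:: a]);
  exists i => //.
  by apply/fsa_path_cat; exists p => //; exists q.
- apply/orP; case: (asboolP (exists w, coreach q w)) => [[s [k fk ps]]|nq];
  last by right.
  by left; apply/asboolP; exists (a :: s); exists k => //; exists q.
- case: asboolP => //= -[w rw]; case: asboolP => //= -[s cs].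
  apply/dAP; rewrite /transition_word /potential /= !nth_v // word_val_cat
    -cat1s.
  rewrite word_val_cat word_val_inv mulgA.
  have rwa : reach q (w ++ [:: a]).
    case: rw => i ii pw; exists i => //; apply/fsa_path_cat; exists p => //;
      by exists q.
  have csa : coreach p (a :: s) by case: cs => k fk ps; exists k => //;
    exists q.
  (* With [w] leading to [p]: [u_p a u_q^-1 = (w u_p^-1)^-1 (w a u_q^-1)]. *)
  have := subgroupM subA (subgroupV subA (trim _ _ _ rw csa)) (trim _ _ _ rwa
    cs).
  by rewrite invgM invgK word_val_cat !mulgA mulgVK.
Qed.
End Relabel.

(** * Effective codes for rational subsets *)

Section RationalCodes.
Local Open Scope group_scope.
Variables (n : nat) (G : groupType) (X : 'I_n -> G) (A : set G) (f : G -> G).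
Notation word := (seq (letter 'I_n)).

(** The interface through which the decision procedure handles rational subsets. It hides the type
    of codes, which are truth values when there are no generators and word automata otherwise. For
    submonoids only the existence of a code is recorded, since they enter as constants. *)
Record rational_codes := RationalCodes {
  rc_type : countType;
  rc_val : rc_type -> set G;
  rc_zero : rc_type;
  rc_word : word -> rc_type;
  rc_add : rc_type * rc_type -> rc_type;
  rc_mul : rc_type * rc_type -> rc_type;
  rc_image : rc_type -> rc_type;
  rc_zeroE : rc_val rc_zero = set0;
  rc_wordE w : rc_val (rc_word w) = [set word_val X w];
  rc_addE p q : rc_val (rc_add (p, q)) = rc_val p `|` rc_val q;
  rc_mulE p q : rc_val (rc_mul (p,
    q)) = [set x * y | x in rc_val p & y in rc_val q];
  rc_imageE p : rc_val (rc_image p) = [set f x | x in rc_val p `&` A];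
  rc_wordsE (l : seq word) : exists p,
    rc_val p = submonoid_gen [set word_val X w | w in [set` l]];
  computable_rc_word : computable rc_word;
  computable_rc_add : computable rc_add;
  computable_rc_mul : computable rc_mul;
  computable_rc_image : computable rc_image;
  decidable_rc : decidable_pred (fun p : rc_type * word =>
    rc_val p.1 (word_val X p.2))
}.

Hypothesis genX : generates X.
Hypothesis ratG : decidable_rational_membership X.
Hypothesis closA : effectively_closed X A.
Hypothesis fM : {in A &, {morph f : x y / x * y}}.

(* Without generators an automaton accepts at most the empty word, so that
   empty transitions could not be simulated. *)
Lemma rational_codes_trivial : n = 0%N -> rational_codes.
Proof.
move=> n0; have tr (g h : G) : g = h.
  by rewrite (trivial_group genX g n0) (trivial_group genX h n0).
have [[A1 _] _ _ _] := closA.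
apply: (@RationalCodes bool (fun b => [set _ | b]) false (fun=> true)
  (fun p => p.1 || p.2) (fun p => p.1 && p.2) id).
- by apply/seteqP; split.
- by move=> w; apply/seteqP; split=> g //= _; exact: tr.
- by move=> p q; apply/seteqP; split=> g /= /orP.
- move=> p q; apply/seteqP; split=> g /=; last by move=> [x -> [y -> _]].
  by move=> /andP[-> ->]; exists 1 => //; exists 1 => //; exact: tr.
- move=> p; apply/seteqP; split=> g /=; last by move=> [x [-> _]].
  by move=> ->; exists 1; [split=> //; exact: set_mem | exact: tr].
- move=> l; exists true; apply/seteqP; split=> g //= _.
  by rewrite (tr g 1) => M [[/set_mem]].
- exact: computable_cst.
- by computability.
- by computability.
- exact: computable_id.
- by exists fst => //; computability.
Qed.

(** To compute an image, unfold the automaton, intersect with [A], run through all numbers until one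
    decodes to a valid certificate, and relabel. That a certificate exists is proved classically,
    but its validity is decidable, so the search is an algorithm. *)
Lemma rational_codes_exist : inhabited rational_codes.
Proof.
have [n0|n_gt0] := posnP n; first by constructor; exact: rational_codes_trivial.
have [subA fgA _ [F cF FE]] := closA.
have [dA cdA dAP] := decidable_fg_subgroup genX ratG subA fgA.
have [fw cfw fwP] := computable_hom_words genX ratG subA fgA fM.
pose x := Ordinal n_gt0.
pose R M := F (unfold_fsa x M).
have RE M : fsa_val X (R M) = wfsa_val X M `&` A by rewrite FE unfold_fsaE.
have [D cD DK] : effective (seq nat * seq nat * seq word)%type.
  have en := effective_seq effective_nat.
  exact: effective_prod (effective_prod en en) (effective_seq (effective_word
    _)).
pose P (p : fsa word * nat) := certified dA (R p.1, D p.2).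
have exP M : exists m, P (M, m).
  have [|c okc] := certificate_exists subA dAP (N := R M).
    by move=> g; rewrite RE => -[].
  by exists (pickle c); rewrite /P /= DK.
have cu := computable_unfold x; have cc := computable_certified cdA.
have cR : computable R by rewrite /R; computability.
have eD : effective (fsa word) by exact/effective_fsa/effective_word.
have cs : computable (fun M => ex_minn (exP M)).
  by apply: computable_search => //; rewrite /P; computability.
have cr := computable_relabel cfw.
constructor; apply: (@RationalCodes (fsa word) (wfsa_val X) (FSA [::] [::] [::])
  (@wfsa_word _) (@wfsa_add _) (@wfsa_mul _)
  (fun M => relabel fw (R M, D (ex_minn (exP M))))).
- by apply/seteqP; split=> g // [ws [p [q []]]].
- exact: wfsa_wordE.
- exact: wfsa_addE.
- exact: wfsa_mulE.
- move=> M; rewrite -RE; apply: (relabelE subA fM dAP fwP).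
  by case: ex_minnP.
- by move=> l; exists (wfsa_words l); exact: wfsa_wordsE.
- exact: computable_wfsa_word.
- exact: computable_wfsa_add.
- exact: computable_wfsa_mul.
- by computability.
- exact: decidable_wfsa.
Qed.
End RationalCodes.

Arguments rc_val {n G X A f} r q : rename.
Arguments rc_word {n G X A f} r w : rename.
Arguments rc_add {n G X A f} r pq : rename.
Arguments rc_mul {n G X A f} r pq : rename.
Arguments rc_image {n G X A f} r q : rename.

(** * The decision procedure *)

(** The list [s] is fixed, so finitely many programs are combined and [F] may depend on [z]
    arbitrarily. This allows indexing by lists over [G], which carry no numbering. *)
Lemma computable_map_family (T U : countType) (Z : Type) (s : seq Z) (F : Z ->
  T -> U) :
  (forall z, computable (F z)) -> computable (fun x => [seq F z x | z <- s]).
Proof.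
move=> cF; elim: s => [|z s IH] /=; first exact: computable_cst.
by have cz := cF z; computability.
Qed.

Section Positive.
Local Open Scope group_scope.
Variables (n : nat) (G : groupType) (X : 'I_n ->
  G) (A B : set G) (phi : G -> G).
Hypothesis genX : generates X.
Hypotheses (subA : is_subgroup A) (subB : is_subgroup B).
Hypothesis isoAB : subgroup_iso A B phi.
Hypotheses (fgA : fg_subgroup A) (fgB : fg_subgroup B).
Hypothesis ratG : decidable_rational_membership X.
Hypothesis closA : effectively_closed X A.
Notation word := (seq (letter 'I_n)).
Notation K := (HNN A phi).
Notation emb := (hnn_emb A phi).
Notation t := (hnn_t A phi).

Definition phi_inv (y : G) : G := xget 1 [set x | A x /\ phi x = y].

Definition assoc_dom (e : bool) : set G := if e then A else B.
Definition assoc_map (e : bool) : G -> G := if e then phi else phi_inv.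

Lemma phi_invP y : B y -> A (phi_inv y) /\ phi (phi_inv y) = y.
Proof.
have [[_ _ surj] _] := isoAB => /surj[x Ax xy].
exact: (@xgetI _ _ [set x | A x /\ phi x = y] x).
Qed.

Lemma phi_invK x : A x -> phi_inv (phi x) = x.
Proof.
move=> Ax; have [[im inj _] _] := isoAB.
have [|Ay E] := @phi_invP (phi x); first exact: im.
by apply: inj => //; exact: mem_set.
Qed.

Lemma assoc_dom_group e : is_subgroup (assoc_dom e).
Proof. by case: e. Qed.

Lemma assoc_map_dom e x : assoc_dom e x -> assoc_dom (~~ e) (assoc_map e x).
Proof.
have [[im _ _] _] := isoAB; case: e => /= dx; first exact: im.
by have [] := phi_invP dx.
Qed.

Lemma assoc_mapM e x y : assoc_dom e x -> assoc_dom e y ->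
  assoc_map e (x * y) = assoc_map e x * assoc_map e y.
Proof.
have [[im inj _] fM] := isoAB; case: e => /= dx dy.
  by rewrite fM //; exact: mem_set.
have [Ax Ex] := phi_invP dx; have [Ay Ey] := phi_invP dy.
rewrite -{1}Ex -{1}Ey -fM ?phi_invK //; try exact: mem_set.
exact: subgroupM.
Qed.

Lemma assoc_mapK e x : assoc_dom e x -> assoc_map (~~ e) (assoc_map e x) = x.
Proof. by case: e => /= dx; [exact: phi_invK | have [] := phi_invP dx]. Qed.

(** * Submonoids generated by positive words *)

Section Generators.
Variable gens : seq (seq G).

(** The list of [g_0, ..., g_k] stands for [g_0 t g_1 ... t g_k]. Allowing all such words as
    generators treats [g t^i] and [t^i g] alike. *)
Fixpoint hnn_syllables (L : seq G) : K :=
  if L is g :: L' then emb g * (if L' is [::] then 1 else t * hnn_syllables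
    L') else 1.

Let M : set K := submonoid_gen [set hnn_syllables L | L in [set` gens]].
(** What the generators without [t] can contribute between the end of one generator and the start of
    the next; the possibly infinite factor in [S_{p,p'}] and [F_p]. *)
Let V : set G := submonoid_gen [set g | [:: g] \in gens].

(* A state is what remains to be read of the current generator. *)
Definition next_syllable (p : seq G) (h : G) (p' : seq G) : Prop :=
  match p with
  | [::] => False
  | [:: x] => exists v g0, [/\ V v, (g0 :: p') \in gens,
    p' <> [::] & h = x * v * g0]
  | x :: rest => h = x /\ p' = rest
  end.

Definition last_syllable (p : seq G) (h : G) : Prop :=
  if p is [:: x] then exists2 v, V v & h = x * v else False.

(* [run p l]: after the syllables [l], last one first and each followed by [t],
   [p] remains to be read. *)
Inductive run : seq G -> seq G -> Prop :=
| run_init : run [:: 1] [::]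
| run_step p h p' l : run p l -> next_syllable p h p' -> run p' (h :: l).

Definition pos (l : seq G) : seq (bool * G) := [seq (true, g) | g <- l].

Local Notation sval := (@syl_val G assoc_dom assoc_map).

Lemma submonoid_genM (H : groupType) (S : set H) x y :
  submonoid_gen S x -> submonoid_gen S y -> submonoid_gen S (x * y).
Proof.
move=> Sx Sy N [[N1 NM] SN].
by apply/set_mem/NM; apply: mem_set; [exact: Sx | exact: Sy].
Qed.

Lemma submonoid_gen1 (H : groupType) (S : set H) : submonoid_gen S 1.
Proof. by move=> N [[/set_mem]]. Qed.

Lemma sub_submonoid_gen (H : groupType) (S : set H) x : S x ->
  submonoid_gen S x.
Proof. by move=> Sx N [_]; exact. Qed.

Lemma emb_V v : V v -> M (emb v).
Proof.
move=> /submonoid_genP[s sV ->]; elim: s sV => [|x s IH] sV.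
  rewrite big_nil; have -> : emb 1 = 1 by exact: (@hnn_emb1 G assoc_dom
    assoc_map).
  exact: submonoid_gen1.
rewrite big_cons hnn_embM; apply: submonoid_genM; last first.
  by apply: IH => y ys; apply: sV; rewrite inE ys orbT.
apply: sub_submonoid_gen; exists [:: x]; last by rewrite /= mulg1.
by apply: sV; rewrite mem_head.
Qed.

(** The invariant completes the generator being read, as a prefix alone need not lie in the
    submonoid. *)
Lemma run_sound p l : run p l -> M (sval (pos l) * hnn_syllables p).
Proof.
elim=> {p l} [|p h p' l rp Mp].
  rewrite /= mulg1 mul1g; have ->
    : emb 1 = 1 by exact: (@hnn_emb1 G assoc_dom assoc_map).
  exact: submonoid_gen1.
case: p rp Mp => [|x [|y rest]] //= _ Mp.
  move=> [v [g0 [Vv g0gens p'ne ->]]].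
  have -> : sval (pos l) * emb (x * v * g0) * t * hnn_syllables p' =
      (sval (pos l) * (emb x * 1)) * (emb v * hnn_syllables (g0 :: p')).
    by rewrite /= !hnn_embM mulg1; case: p' p'ne {g0gens} => // y r _;
      rewrite !mulgA.
  apply: submonoid_genM => //; apply: submonoid_genM; first exact: emb_V.
  by apply: sub_submonoid_gen; exists (g0 :: p').
by move=> [-> ->]; move: Mp; rewrite !mulgA.
Qed.

Lemma run_generator x rest l : run (x :: rest) l ->
  exists y l', run [:: y] l' /\ sval (pos l') * emb y = sval (pos l) *
    hnn_syllables (x :: rest).
Proof.
elim: rest x l => [|y rest IH] x l rx; first by exists x, l; rewrite /= mulg1.
have ry : run (y :: rest) (x :: l) by apply: (run_step rx).
have [z [l' [rz E]]] := IH _ _ ry; exists z, l'; split=> //.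
by rewrite E /= !mulgA.
Qed.

(** Generators are appended one at a time: one without [t] is absorbed into the last syllable, while
    a longer one closes that syllable and is then read to its end. *)
Lemma submonoid_runP k : M k <->
  exists p l h, [/\ run p l, last_syllable p h & k = sval (pos l) * emb h].
Proof.
split=> [/submonoid_genP[s]|[p [l [h [rp]]]]]; last first.
  case: p rp => [|x [|y r]] //= rp [v Vv -> ->]; rewrite hnn_embM mulgA.
  apply: submonoid_genM; last exact: emb_V.
  by have := run_sound rp; rewrite /= mulg1.
elim/last_ind: s k => [|s L IH] k sM ->.
  exists [:: 1], [::], 1; split=> //; first exact: run_init.
    by exists 1; rewrite ?mulg1 //; exact: submonoid_gen1.
  by rewrite big_nil mul1g; apply/esym;
    exact: (@hnn_emb1 G assoc_dom assoc_map).
have [|p [l [h [rp lp E]]]] := IH _ _ (erefl _).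
  by move=> y ys; apply: sM; rewrite mem_rcons inE ys orbT.
rewrite -cats1 big_cat big_seq1 E.
have [|L' L'gens <-] := sM L; first by rewrite mem_rcons mem_head.
case: p rp lp {IH sM E} => [|x [|y r]] //= rp [v Vv ->].
case: L' L'gens => [|g0 [|g1 rest]] Lgens.
- by exists [:: x], l, (x * v); rewrite mulg1; split=> //; exists v.
- exists [:: x], l, (x * (v * g0)); split=> //;
  last by rewrite /= mulg1 !hnn_embM !mulgA.
  by exists (v * g0) => //; apply: submonoid_genM => //;
    exact: sub_submonoid_gen.
have rg : run (g1 :: rest) (x * v * g0 :: l) by apply: (run_step rp);
  exists v, g0.
have [z [l' [rz E]]] := run_generator rg; exists [:: z], l', z; split=> //.
  by exists 1; rewrite ?mulg1 //; exact: submonoid_gen1.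
by rewrite E /= !hnn_embM !mulgA.
Qed.

(** This is [C_p(l)], with [l] listed last syllable first and equality in the extension replaced by
    its combinatorial form. *)
Definition prefix_set (p l : seq G) : set G :=
  [set c | exists2 l', run p l' & syl_eqv assoc_dom assoc_map c (pos l) (pos
    l')].

Lemma prefix_set_nil p : prefix_set p [::] = [set c | p = [:: 1] /\ c = 1].
Proof.
apply/seteqP; split=> c; last first.
  by move=> [-> ->]; exists [::] => //; exact: run_init.
move=> [[|g l] //= rp ->]; split=> //.
by inversion rp.
Qed.

(** Comparing the last syllables [g t] and [h t] yields [a] in [A] with [c = phi a], and the
    discrepancy left for the earlier syllables is [d = g a h^-1]; solving for [a] gives
    [g^-1 d h]. *)
Lemma prefix_set_cons p' g l : prefix_set p' (g :: l) =
  [set phi a | a in [set a | exists p h c,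
     [/\ prefix_set p l c, next_syllable p h p' & a = g^-1 * c * h]] `&` A].
Proof.
apply/seteqP; split=> c.
  move=> [[|h l'] rp' //= [_ [a [Aa -> E]]]]; exists a => //; split=> //.
  inversion rp' as [|p ? ? ? rp np]; subst.
  exists p, h, (g * a * h^-1); split=> //; first by exists l'.
  by rewrite !mulgA mulgVK mulVg mul1g.
move=> [a [[p [h [d [[l' rp E] np ea]]]] Aa] <-]; exists (h :: l').
  exact: run_step rp np.
split=> //; exists a; split=> //.
by rewrite (_ : g * a * h^-1 = d) // ea !mulgA mulgV mul1g mulgK.
Qed.

(** Words read by runs are positive, hence reduced, so equality with the given reduced word amounts
    to [nf_eqv]. This forces positive exponents, and [c = g h^-1] is the discrepancy before the last
    syllable. *)
Lemma nf_in_submonoid g (l : seq (bool * G)) : syl_reduced assoc_dom l ->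
  M (@nf_val G assoc_dom assoc_map (g, l)) <->
  all fst l /\ exists p h c, [/\ prefix_set p (map snd l) c,
    last_syllable p h & g = c * h].
Proof.
have posK l' : all fst l' -> pos (map snd l') = l'.
  by elim: l' => // -[[] x] l' IH //= /IH ->.
have all_pos l' : all fst (pos l') by elim: l'.
have inj := nf_val_inj assoc_dom_group assoc_map_dom assoc_mapM assoc_mapK.
move=> rl; split=> [/submonoid_runP[p [l' [h [rp lp E]]]]|[al [p [h [c [[l' rp
  E] lp ->]]]]]].
  have rl' : syl_reduced assoc_dom (pos l') by
    exact/syl_positive_reduced/all_pos.
  have /= H := (inj (g, l) (h, pos l') rl rl').1 E.
  have al : all fst l by rewrite (syl_eqv_positive H); exact: all_pos.
  split=> //; exists p, h, (g * h^-1); split=> //; last by rewrite mulgVK.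
  by exists l' => //; rewrite posK.
apply/submonoid_runP; exists p, l', h; split=> //.
apply: (nf_eqv_val assoc_map_dom assoc_mapK (s := (_, _)) (s' := (h, pos l'))).
by rewrite /nf_eqv /= mulgK -(posK l).
Qed.

(** * Computing codes of the prefix sets *)

Section Codes.
Variable R : rational_codes X A phi.
Let Q := rc_type R.
Local Notation rval := (rc_val R).

Definition codable (S : set G) : Prop := exists q, rval q = S.

Lemma codable0 : codable set0.
Proof. by exists (rc_zero R); exact: rc_zeroE. Qed.

Lemma codable1 g : codable [set g].
Proof.
have [w <-] := word_val_surj genX g; exists (rc_word R w); exact: rc_wordE.
Qed.

Lemma codableU S T : codable S -> codable T -> codable (S `|` T).
Proof. by move=> [p <-] [q <-]; exists (rc_add R (p, q)); exact: rc_addE. Qed.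

Lemma codableM S T : codable S -> codable T ->
  codable [set x * y | x in S & y in T].
Proof. by move=> [p <-] [q <-]; exists (rc_mul R (p, q)); exact: rc_mulE. Qed.

Lemma codable_seq (s : seq G) : codable [set` s].
Proof.
elim: s => [|x s IH].
  by have [q E] := codable0; exists q; rewrite E; apply/seteqP; split.
have [q E] := codableU (codable1 x) IH; exists q; rewrite E; apply/seteqP;
  split=> g /=.
  by case=> [->|gs]; rewrite inE ?eqxx // gs orbT.
by rewrite inE => /orP[/eqP|]; [left|right].
Qed.

Lemma codableV : codable V.
Proof.
have [|l E] := @finite_set_words _ _ _ genX [set g | [:: g] \in gens].
  apply: (@sub_finite_set _ _ [set` flatten gens]); last exact: finite_seq.
  by move=> g /= gs; apply/flattenP; exists [:: g] => //; rewrite mem_head.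
by rewrite /V E; exact: rc_wordsE.
Qed.

Lemma codable_next p p' : codable [set h | next_syllable p h p'].
Proof.
case: p => [|x [|y rest]]; first exact: codable0.
- have [q E] := codableM (codableM (codable1 x) codableV)
    (codable_seq [seq g0 <- flatten gens | (g0 :: p' \in gens) && (p' !=
      [::])]).
  exists q; rewrite E; apply/seteqP; split=> h /=.
    move=> [_ [_ -> [v Vv <-]] [g0]];
      rewrite mem_filter => /andP[/andP[gg /eqP ne] _] <-.
    by exists v, g0.
  move=> [v [g0 [Vv gg /eqP ne ->]]]; exists (x * v);
    first by exists x => //; exists v.
  exists g0 => //; rewrite mem_filter gg ne /=; apply/flattenP;
    exists (g0 :: p') => //.
  exact: mem_head.
have [->|/eqP ne] := eqVneq p' (y :: rest).
  by have [q E] := codable1 x; exists q; rewrite E; apply/seteqP;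
    split=> h //= [].
by have [q E] := codable0; exists q; rewrite E; apply/seteqP; split=> h //= [].
Qed.

Lemma codable_last p : codable [set h | last_syllable p h].
Proof.
case: p => [|x [|y rest]]; try exact: codable0.
have [q E] := codableM (codable1 x) codableV; exists q; rewrite E.
by apply/seteqP; split=> h /= [y]; [move=> -> [v Vv <-];
  exists v | move=> Vy ->; exists x => //; exists y].
Qed.

(** A choice without an algorithm. It is applied only to finitely many sets determined by the
    generators, so the resulting codes are constants of the procedure. *)
Definition code (S : set G) : Q := xget (rc_zero R) [set q | rval q = S].

Lemma codeE S : codable S -> rval (code S) = S.
Proof. by move=> [q Sq]; exact: (@xgetI _ _ [set q | rval q = S] q). Qed.

(** All suffixes of generators, together with the start state [[:: 1]], which acts like a trivial
    generator about to end. *)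
Definition states : seq (seq G) :=
  [:: 1] :: flatten [seq [seq drop i L | i <- iota 0 (size L).+1] | L <- gens].

Lemma run_states p l : run p l -> p \in states.
Proof.
elim=> {p l} [|p h p' l _ ps np]; first exact: mem_head.
have suffix L i : L \in gens -> (i <= size L)%N -> drop i L \in states.
  move=> Lg le_i; rewrite inE; apply/orP; right; apply/flattenP.
  exists [seq drop i L | i <- iota 0 (size L).+1]; first by apply/mapP;
    exists L.
  by apply/mapP; exists i; rewrite // mem_iota.
case: p ps np => [|x [|y rest]] //= ps.
  by move=> [v [g0 [_ gg _ _]]]; have := suffix _ 1%N gg isT; rewrite /= drop0.
move=> [_ ->]; move: ps; rewrite inE =>
  /orP[/eqP//|/flattenP[_ /mapP[L Lg ->] /mapP[i]]].
rewrite mem_iota ltnS => /andP[_ le_i] E.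
have lt_i : (i < size L)%N by rewrite -subn_gt0 -size_drop -E.
have -> : y :: rest = drop i.+1 L by rewrite -add1n -drop_drop -E /= ?drop0.
exact: suffix.
Qed.

Definition code_sum (s : seq Q) : Q :=
  foldr (fun p q => rc_add R (p, q)) (rc_zero R) s.

Lemma code_sumE (Z : eqType) (s : seq Z) (F : Z -> Q) :
  rval (code_sum [seq F z | z <- s]) = [set g | exists2 z,
    z \in s & rval (F z) g].
Proof.
elim: s => [|z s IH] /=.
  by rewrite rc_zeroE; apply/seteqP; split=> g // [].
rewrite rc_addE IH; apply/seteqP; split=> g /=.
  move=> [Fz|[y ys Fy]]; first by exists z; rewrite ?mem_head.
  by exists y; rewrite // inE ys orbT.
by move=> [y]; rewrite inE => /orP[/eqP->|ys] Fy; [left | right; exists y].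
Qed.

(** The recursion of [prefix_set_cons] on codes: [cs] holds codes of the [C_p(l)] in the order of
    [states], and the sum realises the union over [p]. *)
Definition prefix_step (g : word) (cs : seq Q) : seq Q :=
  [seq rc_image R (code_sum [seq rc_mul R (rc_mul R (rc_word R (word_inv g),
        nth (rc_zero R) cs (index p states)),
          code [set h | next_syllable p h p'])
      | p <- states]) | p' <- states].

Definition prefix_codes (l : seq word) : seq Q :=
  foldr prefix_step [seq code (prefix_set p [::]) | p <- states] l.

Lemma prefix_codesE l p : p \in states ->
  rval (nth (rc_zero R) (prefix_codes l) (index p states)) =
  prefix_set p [seq word_val X g | g <- l].
Proof.
elim: l p => [|g l IH] p ps.
  rewrite (nth_map [::]) ?index_mem // nth_index // codeE // prefix_set_nil.
  have [->|ne] := eqVneq p [:: 1].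
    by have [q E] := codable1 1; exists q; rewrite E; apply/seteqP;
      split=> c //= [].
  have [q E] := codable0; exists q; rewrite E; apply/seteqP;
    split=> c //= [] pe.
  by rewrite pe eqxx in ne.
have -> : prefix_codes (g :: l) = prefix_step g (prefix_codes l) by [].
rewrite (nth_map [::]) ?index_mem // nth_index // prefix_set_cons rc_imageE.
congr (_ @` (_ `&` _)); rewrite code_sumE; apply/seteqP; split=> a /=.
  move=> [p' ps']; rewrite !rc_mulE rc_wordE codeE; last exact: codable_next.
  rewrite IH // => -[_ [_ -> [c cP <-]] [h np <-]].
  by exists p', h, c; rewrite word_val_inv.
(* The finite sum loses nothing, for a state with a nonempty prefix set is reached by a run. *)
move=> [p' [h [c [cP np ->]]]]; have ps' : p' \in states.
  by case: cP => l' /run_states.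
exists p' => //; rewrite !rc_mulE rc_wordE codeE; last exact: codable_next.
rewrite IH //; exists ((word_val X g)^-1 * c); last by exists h.
by exists (word_val X g)^-1; rewrite ?word_val_inv //; exists c.
Qed.

Definition membership_code (l : seq word) : Q :=
  code_sum [seq rc_mul R (nth (rc_zero R) (prefix_codes l) (index p states),
    code [set h | last_syllable p h]) | p <- states].

Lemma membership_codeE l : rval (membership_code l) = [set g | exists p h c,
  [/\ prefix_set p [seq word_val X g | g <- l] c,
    last_syllable p h & g = c * h]].
Proof.
rewrite code_sumE; apply/seteqP; split=> g /=.
  move=> [p ps]; rewrite rc_mulE codeE ?prefix_codesE //;
    last exact: codable_last.
  by move=> [c cP [h lh <-]]; exists p, h, c.
move=> [p [h [c [cP lh ->]]]];
  have ps : p \in states by case: cP => l' /run_states.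
exists p => //; rewrite rc_mulE codeE ?prefix_codesE //;
  last exact: codable_last.
by exists c => //; exists h.
Qed.

Lemma computable_code_sum (T : countType) (s : T -> seq Q) : computable s ->
  computable (fun x => code_sum (s x)).
Proof.
move=> cs; have ca := computable_rc_add R.
apply: (@computable_foldr _ _ _ (fun=> rc_zero R) (fun _ p q =>
  rc_add R (p, q))) => //;
  by computability.
Qed.

Lemma computable_membership_code : computable membership_code.
Proof.
have cm := computable_rc_mul R; have cw := computable_rc_word R.
have ci := computable_rc_image R.
have cstep : computable (fun p : word * seq Q => prefix_step p.1 p.2).
  apply: computable_map_family => p'.
  have : computable (fun p : word * seq Q =>
    code_sum [seq rc_mul R (rc_mul R (rc_word R (word_inv p.1),
        nth (rc_zero R) p.2 (index z states)),
          code [set h | next_syllable z h p'])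
      | z <- states]).
    apply: computable_code_sum; apply: computable_map_family => z.
    by computability.
  by move=> H; computability.
have cp : computable prefix_codes.
  apply: (@computable_foldr _ _ _ (fun=> _) (fun _ => prefix_step));
    try by computability.
  by apply: (computable_comp (f :=
    fun q : seq word * (word * seq Q) => q.2) _ cstep);
    computability.
apply: computable_code_sum; apply: computable_map_family => z.
by computability.
Qed.
End Codes.

(** * Reduction of input words *)

Section Reduction.
Variables (d : bool -> word -> bool) (fw : bool -> word -> word).
Hypothesis cd : forall e, computable (d e).
Hypothesis cfw : forall e, computable (fw e).
Hypothesis dP : forall e w, d e w <-> assoc_dom e (word_val X w).
Hypothesis fwP : forall e w, assoc_dom e (word_val X w) ->
  word_val X (fw e w) = assoc_map e (word_val X w).

(** A version of [nf_push] on words, in which the algorithms [d] and [fw] replace the test for the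
    associated subgroup and the map on it. *)
Definition word_push (s : word * seq (bool * word)) (a : letter (option 'I_n)) :
    word * seq (bool * word) :=
  match a with
  | (Some i, b) => (s.1 ++ [:: (i, b)], s.2)
  | (None, e) =>
      if s.2 is (e', g) :: k then
        if (e' == ~~ e) && d e s.1 then (g ++ fw e s.1, k) else ([::], (e,
          s.1) :: s.2)
      else ([::], (e, s.1) :: s.2)
  end.

Definition hnn_letter (a : letter (option 'I_n)) : G + bool :=
  if a.1 is Some i then inl (letter_val X (i, a.2)) else inr a.2.

Definition nf_word_val (s : word * seq (bool * word)) : G * seq (bool * G) :=
  (word_val X s.1, [seq (x.1, word_val X x.2) | x <- s.2]).

Lemma word_pushE s a :
  nf_word_val (word_push s a) = nf_push assoc_dom assoc_map (nf_word_val s)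
    (hnn_letter a).
Proof.
case: s a => g l [[i|] b]; rewrite /nf_word_val /=.
  by rewrite word_val_cat {2}/word_val big_seq1.
have v1 : word_val X [::] = 1 by rewrite /word_val big_nil.
case: l => [|[e' g'] k] /=; first by rewrite v1.
have -> : d b g = `[< assoc_dom b (word_val X g) >].
  by apply/idP/asboolP => /dP.
case: ifP => [/andP[_ /asboolP db]|_] /=; last by rewrite v1.
by rewrite word_val_cat fwP.
Qed.

Lemma hnn_word_val (w : seq (letter (option 'I_n))) :
  word_val (hnn_generators A phi X) w = hnn_class A phi (map hnn_letter w).
Proof.
elim: w => [|a w IH]; first by rewrite /word_val big_nil.
rewrite -(cat1s a w) word_val_cat IH map_cat hnn_class_cat; congr (_ * _).
rewrite /word_val big_seq1; case: a => [[i|] []] //=; rewrite /letter_val //=.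
  by apply/esym; exact: (@hnn_embV G assoc_dom assoc_map).
by rewrite [LHS]hnn_invE.
Qed.

Lemma computable_word_push : computable (fun p => word_push p.1 p.2).
Proof.
apply: (@computable_ext _ _ (fun p => (fun q =>
  word_push q.2 q.1) (p.2, p.1))) => //.
apply: (computable_comp (f :=
  fun p : (word * seq (bool * word)) * letter (option 'I_n) =>
   (p.2, p.1)) (g := fun q => word_push q.2 q.1)); first by computability.
(* There are finitely many letters, so each may have a program of its own. *)
apply: (@computable_finType_case _ _ _ (fun a s => word_push s a)) =>
  -[[i|] e] /=.
  by computability.
pose h (q : (word * seq (bool * word)) * ((bool * word) * seq (bool * word))) :=
  if (q.2.1.1 == ~~ e) && d e q.1.1 then (q.2.1.2 ++ fw e q.1.1, q.2.2)
  else ([::], (e, q.1.1) :: q.1.2).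
have cde := cd e; have cfe := cfw e.
apply: (@computable_ext _ _ (fun s : word * seq (bool * word) =>
   if s.2 is y :: k then h (s, (y, k)) else ([::], (e, s.1) :: s.2))) =>
     [[g [|[e' g'] k]]|] //.
apply: (@computable_seq_case _ _ _ snd _ h); rewrite /h; computability.
Qed.

Definition word_nf (w : seq (letter (option 'I_n))) :=
  foldl word_push ([::], [::]) w.

Lemma computable_word_nf : computable word_nf.
Proof.
have cp := computable_word_push.
apply: (@computable_foldl _ _ _ (fun=> ([::], [::])) (fun=> word_push));
  try by computability.
by apply: (computable_comp (f := snd) _ cp); computability.
Qed.

Lemma word_nfE w : nf_word_val (word_nf w) =
  foldl (nf_push assoc_dom assoc_map) (1, [::]) (map hnn_letter w).
Proof.
rewrite /word_nf; set s := ([::], [::]).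
have -> : (1, [::]) = nf_word_val s by rewrite /nf_word_val /word_val /=
  big_nil.
by elim: w s => //= a w IH s; rewrite IH word_pushE.
Qed.

Lemma decidable_reduced : decidable_membership (hnn_generators A phi X) M.
Proof.
have [_ fM] := isoAB.
have [R] := rational_codes_exist genX ratG closA fM.
have [m cm mP] := decidable_rc R.
have cc := computable_membership_code R; have cn := computable_word_nf.
(* A [t^-1] that survives reduction rules membership out; otherwise the tail of the reduced word is
   tested against the rational set computed from its syllables. *)
exists (fun w => all fst (word_nf w).2 &&
   m (membership_code R [seq x.2 | x <- (word_nf w).2], (word_nf w).1)).
  by computability.
move=> w; rewrite hnn_word_val.
have nfE : nf_val assoc_dom assoc_map (nf_word_val (word_nf w)) = hnn_class A
  phi (map hnn_letter w).
  rewrite word_nfE (nf_val_push_seq assoc_map_dom assoc_mapK).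
  rewrite /nf_val /= mul1g -[RHS]mul1g; congr (_ * _).
  exact: (@hnn_emb1 G assoc_dom assoc_map).
have red : syl_reduced assoc_dom (nf_word_val (word_nf w)).2.
  by rewrite word_nfE; apply: nf_push_reduced_seq.
rewrite -nfE; apply: (iff_trans _ (iff_sym (nf_in_submonoid _ red)));
  rewrite /= all_map.
have allE : all (preim (fun x => (x.1, word_val X x.2)) fst) (word_nf w).2 =
    all fst (word_nf w).2 by apply: eq_all.
have mapE : [seq x.2 | x <- [seq (x.1, word_val X x.2) | x <- (word_nf w).2]] =
    [seq word_val X g | g <- [seq x.2 | x <- (word_nf w).2]] by rewrite
      -!map_comp.
by rewrite allE mapE; split=> [/andP[-> /mP]|[-> H]] /=;
  [|apply/mP]; rewrite membership_codeE.
Qed.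
End Reduction.

Theorem decidable_syllable_submonoid : decidable_membership (hnn_generators A
  phi X) M.
Proof.
have [_ fM] := isoAB.
have [dA cdA dAP] := decidable_fg_subgroup genX ratG subA fgA.
have [dB cdB dBP] := decidable_fg_subgroup genX ratG subB fgB.
have [fA cfA fAP] := computable_hom_words genX ratG subA fgA fM.
have [|fB cfB fBP] := computable_hom_words genX ratG subB fgB (f := phi_inv).
  by move=> x y /set_mem Bx /set_mem By; exact: (@assoc_mapM false).
by apply: (@decidable_reduced (fun e => if e then dA else dB) (fun e =>
  if e then fA else fB));
  case.
Qed.
End Generators.
End Positive.

(** * Generators of the forms [g t^i] and [t^i g] as positive words *)

Local Open Scope classical_set_scope.
Local Open Scope group_scope.

Theorem theoremD (G : groupType) (n : nat) (X : 'I_n -> G)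
    (A B : set G) (phi : G -> G)
    (genX : generates X)
    (subA : is_subgroup A) (subB : is_subgroup B)
    (isoAB : subgroup_iso A B phi)
    (fgA : fg_subgroup A) (fgB : fg_subgroup B)
    (ratG : decidable_rational_membership X)
    (closA : effectively_closed X A)
    (d : nat) (W W' : nat -> set G)
    (finW : forall i, (i <= d)%N -> finite_set (W i))
    (finW' : forall i, (1 <= i <= d)%N -> finite_set (W' i)) :
  let iota := hnn_emb A phi in
  let t := hnn_t A phi in
  decidable_membership (hnn_generators A phi X)
    (submonoid_gen
      (\bigcup_(i in [set i | (i <= d)%N]) [set iota g * t ^+ i | g in W i] `|`
       \bigcup_(i in [set i | (1 <= i <= d)%N])
         [set t ^+ i * iota g | g in W' i])).
Proof.
move=> iota t.
have iota1 : iota 1 = 1.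
  by apply: (mulgI (iota 1)); rewrite -[LHS]hnn_embM !mulg1.
(* Trivial syllables fill the places between and after the letters [t], so a list of [i.+1]
   syllables carries exactly [i] of them. *)
have sylW i g : hnn_syllables A phi (g :: nseq i 1) = iota g * t ^+ i.
  elim: i g => [|i IH] g //.
  have -> : hnn_syllables A phi (g :: nseq i.+1 1) =
      iota g * (t * hnn_syllables A phi (1 :: nseq i 1)) by [].
  by rewrite IH iota1 mul1g expgS.
have sylW' i g : hnn_syllables A phi (rcons (nseq i 1) g) = t ^+ i * iota g.
  elim: i => [|i IH]; first by rewrite /= mulg1 mul1g.
  rewrite expgS -mulgA -IH /= -/iota iota1 mul1g.
  by case: (rcons _ _) (size_rcons (nseq i 1) g).
have [gens gensE] : exists gens : seq (seq G), [set` gens] =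
    \bigcup_(i in [set i | (i <= d)%N]) [set g :: nseq i 1 | g in W i] `|`
    \bigcup_(i in [set i | (1 <= i <= d)%N]) [set rcons (nseq i 1) g | g in W'
      i].
  have /finite_seqP[s E] : finite_set (
    \bigcup_(i in [set i | (i <= d)%N]) [set g :: nseq i 1 | g in W i] `|`
    \bigcup_(i in [set i | (1 <= i <= d)%N]) [set rcons (nseq i 1) g | g in W'
      i]).
    rewrite finite_setU; split; apply: bigcup_finite.
    - apply: (@sub_finite_set _ _ [set` seq.iota 0 d.+1]);
      last exact: finite_seq.
      by move=> i di; rewrite /mkset mem_iota ltnS.
    - by move=> i /finW/(finite_image (fun g => g :: nseq i 1)).
    - apply: (@sub_finite_set _ _ [set` seq.iota 0 d.+1]);
      last exact: finite_seq.
      by move=> i /andP[_ di]; rewrite /mkset mem_iota ltnS.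
    - by move=> i /finW'/(finite_image (fun g => rcons (nseq i 1) g)).
  by exists s.
have -> : (\bigcup_(i in [set i | (i <= d)%N]) [set iota g * t ^+ i | g in W
  i] `|`
       \bigcup_(i in [set i | (1 <= i <= d)%N]) [set t ^+ i * iota g | g in W'
         i]) =
    [set hnn_syllables A phi L | L in [set` gens]].
  rewrite gensE; apply/seteqP; split=> k.
    move=> [[i di [g Wg <-]]|[i di [g Wg <-]]].
      by exists (g :: nseq i 1); rewrite ?sylW //; left; exists i => //;
        exists g.
    by exists (rcons (nseq i 1) g); rewrite ?sylW' //; right; exists i => //;
      exists g.
  move=> [_ [[i di [g Wg <-]]|[i di [g Wg <-]]] <-].
    by rewrite sylW; left; exists i => //; exists g.
  by rewrite sylW'; right; exists i => //; exists g.
exact: (decidable_syllable_submonoid genX subA subB isoAB fgA fgB ratG closA).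
Qed.
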